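(* Let $d\ge1$ be an integer, $H\in(\tfrac12,1)$, $\alpha=H+\tfrac d2-1$, and let $\{X^\alpha_t\}_{t\in\mathbb R_+}$ be the process $X^\alpha_t=I_d(h^\alpha_t)$. There exist a strictly positive random variable $B_d$ having finite moments of any order and a constant $c_d>3$ such that for all $\omega\in\Omega^*$, $$\sup_{t\in\mathbb R_+}\ \frac{|X^\alpha_t(\omega)|}{(1+|t|)^H\left(\log\log(c_d+|t|)\right)^{\frac d2}}\le B_d(\omega).$$
   Context: Multiple integrals: $\{B_x:x\in\mathbb R\}$ is a two-sided Brownian motion on $(\Omega,\mathcal G,\mathbb P)$, with $\mathcal G$ generated by $B$. $I_d$ is the multiple Wiener-Itô integral of order $d$ with respect to $B$, defined on $L^2(\mathbb R^d)$, with $I_d(f)=I_d(\hat f)$ where $\hat f$ is the symmetrization of $f$, $\mathbb E[I_d(f)]=0$, $\mathbb E[I_d(f)I_d(g)]=d!\langle\hat f,\hat g\rangle_{L^2(\mathbb R^d)}$. The process: for $t\in\mathbb{R}$, $\mathbf t^*=(t,\dots,t)\in\mathbb R^d$. With $H\in(\frac12,1)$ and $\alpha=H+\frac d2-1$, let $k_{\alpha+1}(\mathbf x)=\frac{1}{\gamma_d(\alpha+1)}\|\mathbf x\|_2^{\alpha+1-d}=\frac{1}{\gamma_d(\alpha+1)}\|\mathbf x\|_2^{H-\frac d2}$ with $\gamma_d(\alpha+1)=2^{\alpha+1}\pi^{d/2}\,\Gamma(\frac{\alpha+1}{2})/\Gamma(\frac{d-\alpha-1}{2})$, and $h^\alpha_t(\mathbf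 x)=k_{\alpha+1}(\mathbf t^*-\mathbf x)-k_{\alpha+1}(\mathbf x)$, which is a symmetric function in $L^2(\mathbb R^d)$. Set $X^\alpha_t=I_d(h^\alpha_t)$. Wavelets: $\phi,\psi$ are the Lemarié-Meyer scaling function and mother wavelet on $\mathbb R$: both are in the Schwartz space $S(\mathbb R)$, $\mathrm{supp}\,\mathcal F(\phi)\subset\{|\xi|\le\frac{4\pi}3\}$, $\mathrm{supp}\,\mathcal F(\psi)\subset\{\frac{2\pi}3\le|\xi|\le\frac{8\pi}3\}$, $\{2^{j/2}\psi(2^jx-k):(j,k)\in\mathbb Z^2\}$ is an orthonormal basis of $L^2(\mathbb R)$, and all moments of $\psi$ vanish. $E=\{0,1\}^d\setminus\{(0,\dots,0)\}$; $\psi^{(0)}=\phi$, $\psi^{(1)}=\psi$; for $\epsilon\in E$, $\psi^{(\epsilon)}(\mathbf x)=\psi^{(\epsilon_1)}(x_1)\cdots\psi^{(\epsilon_d)}(x_d)$, and $\psi^{(\epsilon)}_{j,\mathbf k}(\mathbf x)=2^{jd/2}\psi^{(\epsilon)}(2^j\mathbf x-\mathbf k)$. The family $\{\psi^{(\epsilon)}_{j,\mathbf k}\}$ is an orthonormal basis of $L^2(\mathbb R^d)$, and each $\psi^{(\epsilon)}$ belongs to $S_0(\mathbb R^d)$, the space of Schwartz functions all of whose moments vanish. Riesz potential: for $\psi\in S_0(\mathbb R^d)$, $I^{\alpha+1}\psi(\mathbf x)=\int_{\mathbb R^d}k_{\alpha+1}(\mathbf x-\mathbf y)\psi(\mathbf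 y)d\mathbf y$; $I^{\alpha+1}$ maps $S_0(\mathbb R^d)$ to itself. The event $\Omega^*$: an event of probability one on which, for some strictly positive random variable $\tilde C$ with all moments finite, $|I_d(\psi^{(\epsilon)}_{j,\mathbf k})|\le\tilde C(\omega)(\log(e+|j|+\|\mathbf k\|_1))^{d/2}$ for all $(j,\mathbf k,\epsilon)\in\mathbb Z\times\mathbb Z^d\times E$ (such an event exists). Version used: $X^\alpha$ denotes the modification given, for $\omega\in\Omega^*$ and $t\in\mathbb R_+$, by the absolutely convergent series $X^\alpha_t(\omega)=\sum_{j\in\mathbb Z}\sum_{\mathbf k\in\mathbb Z^d}\sum_{\epsilon\in E}2^{-jH}[I^{\alpha+1}(\psi^{(\epsilon)})(2^j\mathbf t^*-\mathbf k)-I^{\alpha+1}(\psi^{(\epsilon)})(-\mathbf k)]I_d(\psi^{(\epsilon)}_{j,\mathbf k})(\omega)$. *)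

(* Defs.v *)
From HB Require Import structures.
From mathcomp Require Import all_boot all_order all_algebra perm complex.
From mathcomp Require Import all_classical all_reals all_analysis.

Set Implicit Arguments.
Unset Strict Implicit.
Unset Printing Implicit Defensive.

Import Order.TTheory GRing.Theory Num.Theory.
Import numFieldNormedType.Exports.

Local Open Scope classical_set_scope.
Local Open Scope ring_scope.

(* R^d is d.-tuple R with its product sigma-algebra. The library has binary
   product measures only, so the Lebesgue measure on R^d is built by iteration. *)
Definition tuple_cons (T : Type) (n : nat) (p : T * n.-tuple T) : n.+1.-tuple T :=
  [the n.+1.-tuple T of p.1 :: p.2].

Fixpoint lebesgue_tuple (R : realType) (n : nat) : set (n.-tuple R) -> \bar R :=
  match n with
  | 0 => fun A => (\d_([tuple] : 0.-tuple R) A)%E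
  | m.+1 => pushforward (lebesgue_measure \x @lebesgue_tuple R m)%E (@tuple_cons R m)
  end.

Section lebesgue_tuple_measure.
Variable R : realType.

Lemma measurable_tuple_cons (n : nat) :
  measurable_fun [set: (measurableTypeR R * n.-tuple R)%type] (@tuple_cons R n).
Proof. exact: measurable_cons. Qed.

Lemma pushforward_tuple_cons_sigma_finite (n : nat)
    (m : {sigma_finite_measure set (n.-tuple R) -> \bar R}) :
  sigma_finite [set: n.+1.-tuple R]
    (pushforward (lebesgue_measure \x m)%E (@tuple_cons R n)).
Proof.
have /sigma_finiteP[F [TF ndF Foo]] := sigma_finiteT (@lebesgue_measure R).
have /sigma_finiteP[G [TG ndG Goo]] := sigma_finiteT m.
pose g (x : n.+1.-tuple R) : measurableTypeR R * n.-tuple R := (thead x, [tuple of behead x]).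
have mg : measurable_fun [set: n.+1.-tuple R] g.
  apply/measurable_fun_pairP; split; first exact: measurable_tnth.
  exact: measurable_behead.
have gK : cancel (@tuple_cons R n) g.
  by move=> [x t]; rewrite /g /tuple_cons /= theadE; congr pair; apply/val_inj.
exists (fun k => g @^-1` (F k `*` G k)).
  apply/seteqP; split=> // x _.
  have [k _ Fk] : (\bigcup_k F k) (thead x) by rewrite -TF.
  have [l _ Gl] : (\bigcup_k G k) [tuple of behead x] by rewrite -TG.
  exists (maxn k l) => //; split => /=.
    by move: Fk; apply/subsetPset/ndF; exact: leq_maxl.
  by move: Gl; apply/subsetPset/ndG; exact: leq_maxr.
move=> k; have [mF Fk] := Foo k; have [mG Gk] := Goo k; split.
  by rewrite -[X in measurable X]setTI; apply: mg => //; exact: measurableX.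
rewrite /pushforward -comp_preimage (_ : g \o _ = id); last first.
  by apply/funext => x; exact: gK.
by rewrite preimage_id product_measure1E// lte_mul_pinfty// ge0_fin_numE.
Qed.

Lemma lebesgue_tuple_sigma_finite (n : nat) :
  exists m : {sigma_finite_measure set (n.-tuple R) -> \bar R},
    @lebesgue_tuple R n = m.
Proof.
elim: n => [|n [m mE]].
  by exists (\d_([tuple] : 0.-tuple R)).
pose q : {measure set (n.+1.-tuple R) -> \bar R} :=
  measure_function_pushforward__canonical__measure_function_Measure
    (lebesgue_measure \x m)%E (@measurable_tuple_cons n).
have qE : @lebesgue_tuple R n.+1 = q by rewrite /= mE.
pose fin := @Measure_isSigmaFinite.Build _ _ _ (Measure.sort q)
  (pushforward_tuple_cons_sigma_finite m).
pose q' := HB.pack_for {sigma_finite_measure set (n.+1.-tuple R) -> \bar R}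
  (Measure.sort q) fin.
by exists q'.
Qed.

Let leb_sf (n : nat) : {sigma_finite_measure set (n.-tuple R) -> \bar R} :=
  sval (cid (lebesgue_tuple_sigma_finite n)).

Let leb_sfE (n : nat) : @lebesgue_tuple R n = leb_sf n.
Proof. exact: svalP (cid (lebesgue_tuple_sigma_finite n)). Qed.

Variable n : nat.

Let leb0 : @lebesgue_tuple R n set0 = 0%E.
Proof. by rewrite leb_sfE measure0. Qed.

Let leb_ge0 A : (0 <= @lebesgue_tuple R n A)%E.
Proof. by rewrite leb_sfE measure_ge0. Qed.

Let leb_sigma_additive : semi_sigma_additive (@lebesgue_tuple R n).
Proof. by rewrite leb_sfE; exact: measure_semi_sigma_additive. Qed.

HB.instance Definition _ := isMeasure.Build _ _ _ (@lebesgue_tuple R n)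
  leb0 leb_ge0 leb_sigma_additive.

Let leb_sigma_finite : sigma_finite setT (@lebesgue_tuple R n).
Proof. by rewrite leb_sfE; exact: sigma_finiteT. Qed.

HB.instance Definition _ := Measure_isSigmaFinite.Build _ _ _
  (@lebesgue_tuple R n) leb_sigma_finite.

End lebesgue_tuple_measure.

Section euclidean_space.
Variables (R : realType) (d : nat).
Implicit Types x y : d.-tuple R.

Definition tuple_sub x y : d.-tuple R := [tuple tnth x i - tnth y i | i < d].

Definition diag_tuple (t : R) : d.-tuple R := [tuple t | i < d].

Definition norm2 x : R := Num.sqrt (\sum_(i < d) tnth x i ^+ 2).

Definition symmetrization (f : d.-tuple R -> R) x : R :=
  (d`!%:R)^-1 * \sum_(s : 'S_d) f [tuple tnth x (s i) | i < d].

End euclidean_space.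

(* Euler's integral for x > 0, extended to non-integral x <= 0 by the functional
   equation; for d = 1 the normalising constant below needs Gamma at the
   negative argument (d - alpha - 1) / 2. *)
Definition Gamma (R : realType) (x : R) : R :=
  let n := if 0 < x then 0%N else (Num.truncn (- x)).+1 in
  (\int[lebesgue_measure]_(t in `]0%R, +oo[%classic)
     (t `^ (x + n%:R - 1) * expR (- t)))
  / \prod_(i < n) (x + i%:R).

(* The Riesz kernel k_a (a stands for alpha + 1), its potential I^a, and the
   function h_t^alpha. *)
Section riesz.
Variables (R : realType) (d : nat).

Definition riesz_gamma (a : R) : R :=
  2 `^ a * pi `^ (d%:R / 2) * Gamma (a / 2) / Gamma ((d%:R - a) / 2).

Definition riesz_kernel (a : R) (x : d.-tuple R) : R :=
  (riesz_gamma a)^-1 * norm2 x `^ (a - d%:R).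

Definition riesz_potential (a : R) (f : d.-tuple R -> R) (x : d.-tuple R) : R :=
  \int[@lebesgue_tuple R d]_y (riesz_kernel a (tuple_sub x y) * f y).

Definition riesz_increment (alpha t : R) (x : d.-tuple R) : R :=
  riesz_kernel (alpha + 1) (tuple_sub (diag_tuple d t) x)
  - riesz_kernel (alpha + 1) x.

End riesz.

(* Mutual independence of increments over consecutive intervals is the product
   rule; subfamilies are covered by taking some of the sets equal to setT. *)
Record two_sided_brownian (R : realType) (disp : measure_display)
    (Omega : measurableType disp) (P : probability Omega R)
    (B : R -> {RV P >-> R}) : Prop := {
  brownian_0 : {ae P, forall w, B 0 w = 0};
  brownian_indep : forall (n : nat) (t : nat -> R) (A : nat -> set R),
    (forall i, (i < n)%N -> t i <= t i.+1) ->
    (forall i, measurable (A i)) ->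
    P (\bigcap_(i < n) [set w | A i (B (t i.+1) w - B (t i) w)]) =
    (\prod_(i < n) P [set w | A i (B (t i.+1) w - B (t i) w)%R])%E;
  brownian_gauss : forall (s t : R) (A : set R), s < t -> measurable A ->
    P [set w | A (B t w - B s w)] = normal_prob 0 (Num.sqrt (t - s)) A;
  brownian_continuous : {ae P, forall w, continuous (fun t => B t w)} }.

Definition generated_by (R : realType) (disp : measure_display)
    (Omega : measurableType disp) (B : R -> Omega -> R) : Prop :=
  @measurable disp Omega =
  <<s \bigcup_(t in [set: R]) preimage_set_system setT (B t) measurable >>.

(* The multiple Wiener-Ito integral of order d with respect to B, as a map on
   square-integrable functions defined up to modification: the linear operator
   with the given values on indicators of off-diagonal boxes (whose span is
   dense) that factors through symmetrization and satisfies the isometry. *)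
Record multiple_Wiener_Ito (R : realType) (disp : measure_display)
    (Omega : measurableType disp) (P : probability Omega R)
    (B : R -> {RV P >-> R}) (d : nat)
    (Id : (d.-tuple R -> R) -> Omega -> R) : Prop := {
  mwi_L2 : forall f, f \in Lfun (@lebesgue_tuple R d) 2%:E ->
    Id f \in Lfun P 2%:E;
  mwi_linear : forall (a : R) f g,
    f \in Lfun (@lebesgue_tuple R d) 2%:E ->
    g \in Lfun (@lebesgue_tuple R d) 2%:E ->
    {ae P, forall w, Id (fun x => a * f x + g x) w = a * Id f w + Id g w};
  mwi_box : forall a b : 'I_d -> R, (forall i, a i <= b i) ->
    trivIset setT (fun i => `]a i, b i]%classic) ->
    {ae P, forall w,
      Id (\1_[set x : d.-tuple R | forall i, tnth x i \in `]a i, b i]]) w =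
      \prod_(i < d) (B (b i) w - B (a i) w)};
  mwi_sym : forall f, f \in Lfun (@lebesgue_tuple R d) 2%:E ->
    {ae P, forall w, Id f w = Id (symmetrization f) w};
  mwi_mean : forall f, f \in Lfun (@lebesgue_tuple R d) 2%:E ->
    ('E_P[Id f] = 0)%E;
  mwi_isometry : forall f g,
    f \in Lfun (@lebesgue_tuple R d) 2%:E ->
    g \in Lfun (@lebesgue_tuple R d) 2%:E ->
    'E_P[Id f \* Id g]%E =
    (d`!%:R * \int[@lebesgue_tuple R d]_x
                (symmetrization f x * symmetrization g x))%:E }.

Section wavelets.
Variable R : realType.
Implicit Types f phi psi : R -> R.

Definition schwartz f : Prop :=
  (forall (n : nat) (x : R), derivable (derive1n n f) x 1) /\
  (forall m n : nat, exists C : R, forall x, `|x ^+ m * derive1n n f x| <= C).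

(* Convention: integral of exp (- i xi x) f x dx, for real-valued f. *)
Definition fourier f (xi : R) : R[i] :=
  ((\int[lebesgue_measure]_x (cos (xi * x) * f x)) +i*
   (- \int[lebesgue_measure]_x (sin (xi * x) * f x)))%C.

Definition fourier_support f : set R := closure [set xi | fourier f xi != 0].

Definition orthonormal_basis (disp : measure_display) (T : measurableType disp)
    (mu : {measure set T -> \bar R}) (J : eqType) (e : J -> T -> R) : Prop :=
  [/\ forall j, e j \in Lfun mu 2%:E,
      forall i j, \int[mu]_x (e i x * e j x) = (i == j)%:R &
      forall f : T -> R, f \in Lfun mu 2%:E -> forall eps : R, 0 < eps ->
        exists (s : seq J) (c : J -> R),
          ('N[mu]_2%:E[EFin \o (fun x => (f x - \sum_(j <- s) c j * e j x)%R)]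
           < eps%:E)%E].

Definition wavelet1 psi (j : int) (k : int) (x : R) : R :=
  2 `^ (j%:~R / 2) * psi (2 ^ j * x - k%:~R).

(* [LM_scaling] expresses that phi is a scaling function to which the mother
   wavelet psi is associated: phi (x - k) and psi_{j,k}, j >= 0, together form
   an orthonormal basis. *)
Record Lemarie_Meyer phi psi : Prop := {
  LM_phi_schwartz : schwartz phi;
  LM_psi_schwartz : schwartz psi;
  LM_phi_support : fourier_support phi `<=` [set xi | `|xi| <= 4 * pi / 3];
  LM_psi_support : fourier_support psi `<=`
    [set xi | 2 * pi / 3 <= `|xi| <= 8 * pi / 3];
  LM_basis : orthonormal_basis (@lebesgue_measure R)
    (fun jk : int * int => wavelet1 psi jk.1 jk.2);
  LM_scaling : orthonormal_basis (@lebesgue_measure R)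
    (fun i : int + nat * int => match i with
       | inl k => fun x => phi (x - k%:~R)
       | inr jk => wavelet1 psi (Posz jk.1) jk.2
       end);
  LM_moments : forall n : nat, \int[lebesgue_measure]_x (x ^+ n * psi x) = 0 }.

Variable d : nat.

(* {0,1}^d is d.-tuple bool, with true for psi and false for phi. *)
Definition nonzero_type : pred (d.-tuple bool) :=
  fun eps => [exists i, tnth eps i].

Definition tensor_wavelet phi psi (eps : d.-tuple bool) (x : d.-tuple R) : R :=
  \prod_(i < d) (if tnth eps i then psi else phi) (tnth x i).

Definition dilate (j : int) (k : d.-tuple int) (x : d.-tuple R) : d.-tuple R :=
  [tuple 2 ^ j * tnth x i - (tnth k i)%:~R | i < d].

Definition wavelet phi psi (j : int) (k : d.-tuple int) (eps : d.-tuple bool)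
    (x : d.-tuple R) : R :=
  2 `^ (j%:~R * d%:R / 2) * tensor_wavelet phi psi eps (dilate j k x).

End wavelets.

(* The value of an absolutely convergent sum of reals over D; as a total
   operation, an infinite positive or negative part counts as 0. *)
Definition abs_sum (R : realType) (T : choiceType) (D : set T) (f : T -> R) : R :=
  fine (\esum_(i in D) (Num.max (f i) 0)%:E)
  - fine (\esum_(i in D) (Num.max (- f i) 0)%:E).

Definition moments_finite (R : realType) (disp : measure_display)
    (Omega : measurableType disp) (P : probability Omega R) (C : Omega -> R) :
    Prop :=
  forall p : nat, P.-integrable setT (fun w => (`|C w| ^+ p)%:E).

Section process.
Variables (R : realType) (disp : measure_display) (Omega : measurableType disp).
Variables (P : probability Omega R) (d : nat).
Variables (Id : (d.-tuple R -> R) -> Omega -> R) (phi psi : R -> R).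

Definition is_Omega_star (Os : set Omega) : Prop :=
  [/\ measurable Os, P Os = 1%E &
   exists C : {RV P >-> R},
   [/\ forall w, 0 < C w, moments_finite P C &
    forall w, Os w -> forall (j : int) (k : d.-tuple int) (eps : d.-tuple bool),
      nonzero_type eps ->
      `|Id (wavelet phi psi j k eps) w| <=
      C w * ln (expR 1 + `|j|%:~R + (\sum_(i < d) `|tnth k i|)%:~R)
              `^ (d%:R / 2)]].

Definition wavelet_series (H alpha t : R) (w : Omega) : R :=
  abs_sum [set z : int * d.-tuple int * d.-tuple bool | nonzero_type z.2]
    (fun z => let: (j, k, eps) := z in
       2 `^ (- j%:~R * H)
       * (riesz_potential (alpha + 1) (tensor_wavelet phi psi eps)
            (dilate j k (diag_tuple d t))
          - riesz_potential (alpha + 1) (tensor_wavelet phi psi eps)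
            (dilate j k (diag_tuple d 0)))
       * Id (wavelet phi psi j k eps) w).

End process.

(* Main.v *)
From HB Require Import structures.
Require Import Defs.
From mathcomp Require Import all_boot all_order all_algebra.
From mathcomp Require Import all_classical all_reals all_analysis.
From mathcomp Require Import finmap measurable_realfun ring lra.

Set Implicit Arguments.
Unset Strict Implicit.
Unset Printing Implicit Defensive.

Import Order.TTheory GRing.Theory Num.Theory.
Import numFieldNormedType.Exports.

Local Open Scope classical_set_scope.
Local Open Scope ring_scope.

(** The bound is pathwise: on Omega_star it reduces to the deterministic estimate
    sum_{j,k,eps} 2^{-jH} |Theta(2^j t* - k) - Theta(-k)| log(e+|j|+|k|)^{d/2}
      <= C (1+t)^H (loglog(c+t))^{d/2},   Theta = I^{alpha+1} psi^(eps).

    Localisation of Theta.  With r = |x-y|^2 and a = d/4 - H/2, the Riesz kernel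
    is a mixture of Gaussians: r^{-a} is proportional to the integral over v in R
    of e^{av} (exp(-e^v r) - b), where b = 0 if d >= 2 and b = 1 if d = 1 (then
    a < 0).  The b-term is killed by the vanishing integral of psi, and a Gaussian
    factorises over coordinates, so Theta(x) is proportional to the integral of
    e^{av} prod_i (g_v * psi^(eps_i))(x_i).  Everything is now one-dimensional: for
    l = e^{v/2} >= 1 the convolution is O(l^{-1}), for l <= 1 it is O(l^{-p}) and,
    by Taylor expansion against the vanishing moments of psi, O(l^{M-p}), each time
    with the decay (1+|x|)^{-p}.  The same bounds applied to f(.+s) - f control the
    increments of Theta.

    Summation.  With T = 1+t and 2^{n0} <= T < 2^{n0+1}, the sum over k costs
    log(e + |j| + d 2^j T)^{d/2} and the j-th level decays geometrically in
    |j + n0|, whence T^H log(e+n0)^{d/2}. *)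

(** * Polynomial decay weights *)

Section decay_weight.
Variable R : realType.
Implicit Types (x y l : R) (p q n : nat).

Definition wt p x : R := (1 + `|x|) ^- p.

Lemma onenorm_gt0 x : 0 < 1 + `|x| :> R.
Proof. by rewrite ltr_pwDl. Qed.

Lemma onenorm_ge1 x : 1 <= 1 + `|x| :> R.
Proof. by rewrite lerDl. Qed.

Lemma wt_gt0 p x : 0 < wt p x.
Proof. by rewrite invr_gt0 exprn_gt0// onenorm_gt0. Qed.

Lemma wt_ge0 p x : 0 <= wt p x. Proof. exact/ltW/wt_gt0. Qed.

Lemma wt_le1 p x : wt p x <= 1.
Proof. by rewrite invf_le1 ?exprn_gt0 ?onenorm_gt0// exprn_ege1// onenorm_ge1. Qed.

Lemma wtD p q x : wt (p + q) x = wt p x * wt q x.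
Proof. by rewrite /wt exprD invfM. Qed.

Lemma wtVK p x : (1 + `|x|) ^+ p * wt p x = 1.
Proof. by rewrite divff// expf_neq0// gt_eqF// onenorm_gt0. Qed.

Lemma wt_le p q x : (p <= q)%N -> wt q x <= wt p x.
Proof. by move=> pq; rewrite -(subnK pq) wtD ler_piMl ?wt_ge0 ?wt_le1. Qed.

Lemma onenormD x y : 1 + `|x + y| <= (1 + `|x|) * (1 + `|y|) :> R.
Proof.
apply: (@le_trans _ _ (1 + (`|x| + `|y|))); first by rewrite lerD2l ler_normD.
by have := mulr_ge0 (normr_ge0 x) (normr_ge0 y); lra.
Qed.

(** Submultiplicativity of 1+|x|, raised to the power -p. It transfers the decay of a convolution
    integrand in x-y and y to decay in x. *)
Lemma wt_triangle p x y : wt p (x - y) * wt p y <= wt p x.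
Proof.
rewrite -invfM -exprMn lef_pV2 ?posrE ?exprn_gt0 ?mulr_gt0 ?onenorm_gt0//.
rewrite lerXn2r ?nnegrE ?mulr_ge0// ?(ltW (onenorm_gt0 _))//.
by have := onenormD (x - y) y; rewrite subrK.
Qed.

(* Peetre's inequality. *)
Lemma wt_shift p x y : wt p (x - y) <= (1 + `|y|) ^+ p * wt p x.
Proof.
by rewrite mulrC -ler_pdivrMr ?exprn_gt0 ?onenorm_gt0// wt_triangle.
Qed.

(** For l <= 1 one has l (1+|x|) <= 1 + l|x|, so the dilation costs only the factor l^-p. *)
Lemma wt_scale p l x : 0 < l -> l <= 1 -> wt p (l * x) <= l ^- p * wt p x.
Proof.
move=> l0 l1; rewrite -invfM -exprMn lef_pV2 ?posrE ?exprn_gt0 ?mulr_gt0 ?onenorm_gt0//.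
rewrite lerXn2r ?nnegrE ?mulr_ge0// ?(ltW (onenorm_gt0 _))// ?(ltW l0)//.
by rewrite mulrDr mulr1 normrM (gtr0_norm l0) lerD2r.
Qed.

(** From 1+z <= e^z, 1+|x| is at most (p+1) e^{|x|/p}; the p-th power gives the bound, p = 0 being
    treated apart. *)
Lemma expRN_le_wt p : exists2 C : R, 0 < C &
  forall x, expR (- `|x|) <= C * wt p x.
Proof.
exists (p.+1%:R ^+ p) => [|x]; first by rewrite exprn_gt0.
rewrite expRN ler_pdivlMr ?exprn_gt0 ?onenorm_gt0// mulrC.
rewrite ler_pdivrMr ?expR_gt0//.
case: p => [|p]; first by rewrite !expr0 mul1r -[leLHS]expR0 ler_expR.
have -> : expR `|x| = expR (`|x| / p.+1%:R) ^+ p.+1.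
  by rewrite -expRM_natl mulrC divfK.
rewrite -exprMn lerXn2r ?nnegrE ?mulr_ge0 ?expR_ge0 ?(ltW (onenorm_gt0 _))//.
have := expR_ge1Dx (`|x| / p.+1%:R) => /(ler_wpM2l (ler0n R p.+2)).
apply: le_trans; rewrite mulrDr mulr1 lerD ?ler1n//.
by rewrite mulrCA ler_peMr// ler_pdivlMr ?mul1r ?ltr0n ?ler_nat.
Qed.

(** Since (|x|-1)^2 >= 0, one has -x^2 <= 1-|x|: the Gaussian reduces to the exponential at the
    price of a factor e. *)
Lemma gauss_le_wt p : exists2 C : R, 0 < C &
  forall x, expR (- x ^+ 2) <= C * wt p x.
Proof.
have [C C0 CP] := expRN_le_wt p; exists (expR 1 * C) => [|x].
  by rewrite mulr_gt0 ?expR_gt0.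
rewrite -mulrA; apply: le_trans (ler_wpM2l (expR_ge0 1) (CP x)).
rewrite -expRD ler_expR -real_normK ?num_real//.
by have := sqr_ge0 (`|x| - 1); have := normr_ge0 x; nra.
Qed.

End decay_weight.

(** * Taylor expansion of the Gaussian *)

Section taylor.
Variable R : realType.

(** Either order of a and b is allowed, and c is located by its distance to a, so that Taylor's
    formula can be run on both sides of 0. *)
Lemma mean_value (f df : R -> R) (a b : R) :
  (forall x : R, is_derive x 1 f (df x)) ->
  exists c, `|c - a| <= `|b - a| /\ f b - f a = df c * (b - a).
Proof.
move=> fdf.
have cf x : {for x, continuous f}.
  exact/differentiable_continuous/derivable1_diffP/ex_derive.
have [ab|/ltW ba] := leP a b.
  have [c + ->] := @MVT_segment R f df a b ab (fun x _ => fdf x)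
    (continuous_subspaceT cf).
  rewrite in_itv/= => /andP[ac cb]; exists c; split => //.
  by rewrite !ger0_norm ?subr_ge0// lerD2r.
have [c + E] := @MVT_segment R f df b a ba (fun x _ => fdf x)
  (continuous_subspaceT cf).
rewrite in_itv/= => /andP[bc ca]; exists c; split.
  by rewrite !ler0_norm ?subr_le0// lerN2 lerD2r.
by rewrite -opprB E -mulrN opprB.
Qed.

Lemma poly_primitive (Q : {poly R}) (c : R) (n : nat) : (size Q <= n)%N ->
  exists P : {poly R}, [/\ (size P <= n.+1)%N, P^`() = Q & P.[0] = c].
Proof.
move=> sQ; exists (\poly_(i < n.+1) if i is k.+1 then Q`_k / k.+1%:R else c).
split; first exact: size_poly.
  apply/polyP => i; rewrite coef_deriv coef_poly ltnS.
  case: ltnP => [_|ni]; first by rewrite -[LHS]mulr_natr divfK.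
  by rewrite mul0rn nth_default// (leq_trans sQ).
by rewrite horner_coef0 coef_poly.
Qed.

(** Induction: the polynomial for [F 0] is the primitive, with the right value at 0, of the one for
    [F 1], and the mean value theorem turns the error for [F 1] into an error with one more factor
    |y|. The gain 1/n! is given up. *)
Lemma taylor_poly (F : nat -> R -> R) (n : nat) :
  (forall k (x : R), is_derive x 1 (F k) (F k.+1 x)) ->
  exists2 Q : {poly R}, (size Q <= n)%N & forall y B,
    (forall xi, `|xi| <= `|y| -> `|F n xi| <= B) ->
    `|F 0%N y - Q.[y]| <= B * `|y| ^+ n.
Proof.
elim: n F => [|n IH] F dF.
  by exists 0 => [|y B]; rewrite ?size_poly0// horner0 subr0 expr0 mulr1; exact.
have [Q sQ QP] := IH (fun k => F k.+1) (fun k => dF k.+1).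
have [P [sP dP P0]] := poly_primitive (F 0%N 0) sQ.
exists P => // y B FB.
have dg (x : R) : is_derive x 1 (fun y => F 0%N y - P.[y]) (F 1%N x - Q.[x]).
  by rewrite -dP; apply: is_deriveB.
have [c []] := mean_value 0 y dg.
rewrite !subr0 P0 subrr subr0 => cy ->.
rewrite normrM exprSr mulrA ler_wpM2r//.
have B0 : 0 <= B by rewrite (le_trans _ (FB 0 _)) ?normr0.
have /le_trans -> // := QP c B (fun xi xic => FB xi (le_trans xic cy)).
by rewrite ler_wpM2l// lerXn2r ?nnegrE.
Qed.

End taylor.

Section gauss_taylor.
Variable R : realType.

(** Up to the sign (-1)^n, these are the physicists' Hermite polynomials. *)
Definition hermite n : {poly R} := iter n (fun P => P^`() - 2%:P * 'X * P) 1.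

Definition gauss_deriv n (x : R) : R := (hermite n).[x] * expR (- x ^+ 2).

Lemma is_derive_gauss n (x : R) : is_derive x 1 (gauss_deriv n) (gauss_deriv n.+1 x).
Proof.
rewrite /gauss_deriv.
have d1 : is_derive x 1 (fun x : R => expR (- x ^+ 2)) (- (2 * x) * expR (- x ^+ 2)).
  have d0 : is_derive x 1 (fun x : R => - x ^+ 2) (- (2 * x)).
    by apply: is_derive_eq; rewrite /GRing.scale/=; ring.
  by apply: is_derive_eq (is_derive1_comp _ d0) _; rewrite mulrC.
apply: is_derive_eq (is_deriveM (is_derive_poly (hermite n) x) d1) _.
by rewrite /= !hornerE /GRing.scale/=; ring.
Qed.

Lemma poly_le_onenorm (P : {poly R}) : exists2 C : R, 0 <= C &
  forall x, `|P.[x]| <= C * (1 + `|x|) ^+ size P.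
Proof.
exists (\sum_(i < size P) `|P`_i|) => [|x]; first exact: sumr_ge0.
rewrite horner_coef mulr_suml (le_trans (ler_norm_sum _ _ _))// ler_sum// => i _.
rewrite normrM ler_wpM2l// normrX (@le_trans _ _ ((1 + `|x|) ^+ i))//.
  by rewrite lerXn2r ?nnegrE ?lerDr ?(ltW (onenorm_gt0 _)).
by rewrite ler_weXn2l ?onenorm_ge1// ltnW.
Qed.

Lemma gauss_deriv_le_wt n p : exists2 C : R, 0 <= C &
  forall x, `|gauss_deriv n x| <= C * wt p x.
Proof.
have [C C0 CP] := poly_le_onenorm (hermite n).
have [D D0 DP] := gauss_le_wt R (size (hermite n) + p).
exists (C * D) => [|x]; first by rewrite mulr_ge0// ltW.
rewrite normrM (ger0_norm (expR_ge0 _)).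
apply: le_trans (ler_pM (normr_ge0 _) (expR_ge0 _) (CP x) (DP x)) _.
by rewrite wtD mulrACA (mulrA (_ ^+ _)) wtVK mul1r.
Qed.

(** The M-th derivative in y carries l^M. It is evaluated at some xi with |xi| <= |y|, and Peetre's
    inequality brings its decay from x-xi back to x for a factor (1+|y|)^p. [Q] may depend on l and
    x; against vanishing moments only its being a polynomial counts. *)
Lemma gauss_taylor (M p : nat) : exists2 C : R, 0 <= C &
  forall l x : R, 0 < l -> l <= 1 -> exists2 Q : {poly R}, (size Q <= M)%N &
  forall y, `|expR (- (l * (x - y)) ^+ 2) - Q.[y]| <=
    C * l ^+ M * l ^- p * wt p x * (1 + `|y|) ^+ (M + p).
Proof.
have [C C0 CP] := gauss_deriv_le_wt M p; exists C => // l x l0 l1.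
(* The k-th derivative in y of the Gaussian centred at x, by the chain rule. *)
pose F k y := (- l) ^+ k * gauss_deriv k (l * (x - y)).
have dF k (y : R) : is_derive y 1 (F k) (F k.+1 y).
  have d1 : is_derive y 1 (fun y => l * (x - y)) (- l).
    by apply: is_derive_eq; rewrite /GRing.scale/=; ring.
  have d2 := @is_derive1_comp R _ (fun y => l * (x - y)) _ _ _
    (is_derive_gauss k (l * (x - y))) d1.
  apply: is_derive_eq (is_deriveZ ((- l) ^+ k) d2) _.
  by rewrite /F exprS /GRing.scale/=; ring.
have [Q sQ QP] := taylor_poly M dF; exists Q => // y.
have -> : expR (- (l * (x - y)) ^+ 2) = F 0%N y.
  by rewrite /F expr0 mul1r /gauss_deriv /hermite/= hornerC mul1r.
have := QP y (l ^+ M * (C * (l ^- p * wt p x * (1 + `|y|) ^+ p))).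
move=> H; apply: le_trans (H _) _.
  move=> xi xiy; rewrite /F normrM normrX normrN (gtr0_norm l0).
  rewrite ler_wpM2l ?exprn_ge0 ?(ltW l0)//.
  apply: le_trans (CP _) _; rewrite ler_wpM2l//.
  apply: le_trans (wt_scale _ _ l0 l1) _.
  rewrite -mulrA ler_wpM2l ?invr_ge0 ?exprn_ge0 ?(ltW l0)//.
  rewrite (le_trans (wt_shift _ _ _))// mulrC ler_wpM2l ?wt_ge0//.
  by rewrite lerXn2r ?nnegrE ?lerD2l// ltW ?onenorm_gt0.
rewrite addnC exprD.
have -> : C * l ^+ M * l ^- p * wt p x * ((1 + `|y|) ^+ p * (1 + `|y|) ^+ M) =
  l ^+ M * (C * (l ^- p * wt p x * (1 + `|y|) ^+ p)) * (1 + `|y|) ^+ M by ring.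
rewrite ler_wpM2l ?lerXn2r ?nnegrE ?lerDr ?(ltW (onenorm_gt0 _))//.
by rewrite !mulr_ge0 ?invr_ge0 ?exprn_ge0 ?wt_ge0 ?(ltW l0) ?(ltW (onenorm_gt0 _)).
Qed.

End gauss_taylor.

(** * Integrals on the line *)

Section domination.
Context d (T : measurableType d) (R : realType) (nu : {measure set T -> \bar R}).
Implicit Types f g : T -> R.

Lemma dominated_integrable f g : measurable_fun setT f ->
  nu.-integrable setT (EFin \o g) -> (forall x, `|f x| <= g x) ->
  nu.-integrable setT (EFin \o f).
Proof.
move=> mf ig fg; apply: le_integrable ig => //; first exact/measurable_EFinP.
by move=> x _ /=; rewrite lee_fin (le_trans (fg x))// ler_norm.
Qed.

Lemma dominated_Rintegral f g : measurable_fun setT f ->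
  nu.-integrable setT (EFin \o g) -> (forall x, `|f x| <= g x) ->
  `|\int[nu]_x f x| <= \int[nu]_x g x.
Proof.
move=> mf ig fg; have if_ := dominated_integrable mf ig fg.
apply: le_trans (le_normr_Rintegral measurableT if_) _.
apply: le_Rintegral => //.
apply: (dominated_integrable _ ig); first exact: measurableT_comp.
by move=> x; rewrite normr_id.
Qed.

End domination.

Section line_integrals.
Variable R : realType.
Local Notation mu := (@lebesgue_measure R).

(** By uniqueness of Lebesgue measure, comparison on half-open intervals suffices. *)
Lemma lebesgue_measure_shift (s : R) (A : set R) : measurable A ->
  pushforward mu (fun x : measurableTypeR R => x + s : measurableTypeR R) A = mu A.
Proof.
have ms : measurable_fun [set: measurableTypeR R]
    (fun x : measurableTypeR R => x + s : measurableTypeR R).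
  exact: measurable_funD.
pose nu := measure_function_pushforward__canonical__measure_function_Measure mu ms.
move=> mA; apply/esym/(@lebesgue_measure_unique R nu) => //= _ [[a b]] _ <-.
rewrite /pushforward/=.
rewrite (_ : _ @^-1` _ = `]a - s, b - s]%classic); last first.
  by apply/seteqP; split => x /=; rewrite !in_itv/= ltrBlDr lerBrDr.
by rewrite !lebesgue_measure_itv/= !lte_fin ltrD2r -!EFinB; case: ifP => // _; congr EFin; ring.
Qed.

Lemma integral_shift (f : R -> \bar R) (s : R) : measurable_fun setT f ->
  (\int[mu]_x f (x + s)%R = \int[mu]_x f x)%E.
Proof.
pose sh (x : measurableTypeR R) : measurableTypeR R := x + s.
have ms : measurable_fun setT sh by exact: measurable_funD.
have ge0_shift (g : R -> \bar R) : measurable_fun setT g -> (forall x, 0 <= g x)%E ->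
    (\int[mu]_x g (x + s)%R = \int[mu]_x g x)%E.
  move=> mg g0; transitivity (\int[pushforward mu sh]_x g x)%E.
    by rewrite ge0_integral_pushforward.
  by apply: eq_measure_integral => A mA _; exact: lebesgue_measure_shift.
move=> mf; rewrite integralE [RHS]integralE.
rewrite -(ge0_shift (f^\+)%E)//; last exact: measurable_funepos.
rewrite -(ge0_shift (f^\-)%E)//; last exact: measurable_funeneg.
by congr (_ + oppe _)%E; apply: eq_integral => x _; rewrite (funepos_comp,funeneg_comp).

Qed.

Lemma Rintegral_shift (f : R -> R) (s : R) : measurable_fun setT f ->
  \int[mu]_x f (x + s) = \int[mu]_x f x.
Proof.
by move=> mf; congr fine; apply: (integral_shift (f := EFin \o f)); exact/measurable_EFinP.
Qed.

Lemma measurable_wt p : measurable_fun setT (@wt R p).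
Proof.
apply: continuous_measurable_fun => x.
have cx : {for x, continuous (fun z : R => (1 + `|z|) ^+ p)}.
  apply: (@continuous_comp _ _ _ (fun x : R => 1 + `|x| : R) (@GRing.exp R ^~ p)).
    by apply: cvgD; [exact: cvg_cst|exact: norm_continuous].
  exact: exprn_continuous.
by apply: cvgV cx; rewrite gt_eqF// exprn_gt0// onenorm_gt0.
Qed.

(** Comparison with 1/(1+x^2), an even function whose integral over the half-line is known. *)
Lemma integrable_wt2 : mu.-integrable setT (EFin \o @wt R 2).
Proof.
apply: (@dominated_integrable _ _ R mu (wt 2) (fun x => (oneDsqr x)^-1)).
- exact: measurable_wt.
- apply/integrableP; split.
    apply/measurable_EFinP; apply: continuous_measurable_fun.
    exact: continuous_oneDsqrV.
  under eq_integral => x _ do rewrite /= ger0_norm ?invr_ge0 ?(le_trans _ (oneDsqr_ge1 x))//.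
  rewrite ge0_symfun_integralT; first last.
  + by move=> x /=; rewrite /oneDsqr sqrrN.
  + exact: continuous_oneDsqrV.
  + by move=> x; rewrite invr_ge0 (le_trans _ (oneDsqr_ge1 x)).
  by rewrite -set_itvcy integral0y_oneDsqr ltry.
- move=> x; rewrite ger0_norm ?wt_ge0//.
  rewrite lef_pV2 ?posrE ?exprn_gt0 ?onenorm_gt0 ?(lt_le_trans _ (oneDsqr_ge1 x))//.
  by rewrite /oneDsqr -(real_normK (num_real x)); have := normr_ge0 x; nra.
Qed.

(** The integrand is a multiple of the normal density of mean x and standard deviation 1/l. *)
Lemma gauss_integral (l x : R) : 0 < l ->
  mu.-integrable setT (EFin \o (fun y => expR (- (l * (x - y)) ^+ 2 / 2))) /\
  \int[mu]_y expR (- (l * (x - y)) ^+ 2 / 2) = Num.sqrt (pi *+ 2) / l.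
Proof.
move=> l0; have l0' : l^-1 != 0 by rewrite invr_neq0// gt_eqF.
have E : (fun y => expR (- (l * (x - y)) ^+ 2 / 2)) =
    (fun y => Num.sqrt (pi *+ 2) / l * normal_pdf x l^-1 y).
  apply/funext => y; rewrite normal_pdfE// /normal_peak /normal_fun.
  rewrite -[_ * pi *+ 2]mulrnAr sqrtrM ?sqr_ge0// sqrtr_sqr ger0_norm ?invr_ge0 ?ltW//.
  rewrite mulrA invfM invrK (mulrC l) mulrA.
  rewrite -(mulrA (Num.sqrt _)) mulVf ?gt_eqF// mulr1 divff ?mul1r; last first.
    by rewrite gt_eqF// sqrtr_gt0 mulrn_wgt0// pi_gt0.
  congr expR; field.
  by rewrite gt_eqF.
have i0 : mu.-integrable setT (EFin \o normal_pdf x l^-1) by exact: integrable_normal_pdf.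
rewrite E; split.
  by apply: integrableZl i0.
rewrite RintegralZl// /Rintegral integral_normal_pdf mulr1.
by [].
Qed.

End line_integrals.

(** * Convolution with a Gaussian *)

Section gauss_convolution.
Variable R : realType.
Local Notation mu := (@lebesgue_measure R).
Implicit Types (f g : R -> R) (l x K : R) (p M : nat).

(** The Gaussian is not normalised: its mass is of order 1/l, and large l means a narrow
    Gaussian. *)
Definition gconv l f x : R := \int[mu]_y (expR (- (l * (x - y)) ^+ 2) * f y).

(** Polynomials instead of monomials, so that a Taylor polynomial is subtracted at once and a
    translation of f becomes a composition inside [Q]. *)
Definition vanishing_moments f :=
  forall Q : {poly R}, \int[mu]_y (Q.[y] * f y) = 0.

Lemma measurable_gauss l x :
  measurable_fun setT (fun y : R => expR (- (l * (x - y)) ^+ 2)).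
Proof.
apply: measurableT_comp => //; apply: measurableT_comp => //.
apply: measurable_funX; apply: measurable_funM => //.
exact: measurable_funB.
Qed.

Lemma decay_ge0 K f p : (forall y, `|f y| <= K * wt p y) -> 0 <= K.
Proof.
by move=> /(_ 0)/(le_trans (normr_ge0 _)); rewrite pmulr_lge0// wt_gt0.
Qed.

Lemma decay_le K f p q : (p <= q)%N ->
  (forall y, `|f y| <= K * wt q y) -> forall y, `|f y| <= K * wt p y.
Proof.
move=> pq fK y; rewrite (le_trans (fK y))// ler_wpM2l ?(decay_ge0 fK)//.
exact: wt_le.
Qed.

Lemma integrable_wt2Z K : mu.-integrable setT (EFin \o (fun y => K * wt 2 y)).
Proof. by apply: integrableZl (integrable_wt2 R). Qed.

Lemma gconv_integrable l f x K : measurable_fun setT f ->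
  (forall y, `|f y| <= K * wt 2 y) ->
  mu.-integrable setT (EFin \o (fun y => expR (- (l * (x - y)) ^+ 2) * f y)).
Proof.
move=> mf fK; apply: (@dominated_integrable _ _ R mu _ (fun y => K * wt 2 y)).
- by apply: measurable_funM => //; exact: measurable_gauss.
- exact: integrable_wt2Z.
- move=> y; rewrite normrM (le_trans _ (fK y))// ler_piMl// ger0_norm ?expR_ge0//.
  by rewrite -[leRHS]expR0 ler_expR oppr_le0 sqr_ge0.
Qed.

(** Half of the Gaussian exponent is integrated and yields the mass of order 1/l; since l >= 1, the
    other half is dominated by a fixed Gaussian in x-y and yields the decay. *)
Lemma gconv_le_large p : exists2 C : R, 0 <= C & forall K f l x, 1 <= l ->
  measurable_fun setT f -> (forall y, `|f y| <= K * wt p y) ->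
  `|gconv l f x| <= C * K / l * wt p x.
Proof.
have [C C0 CP] := gauss_le_wt R p.
exists (C * 2 ^+ p * Num.sqrt (pi *+ 2)).
  by rewrite !mulr_ge0 ?sqrtr_ge0 ?(ltW C0).
move=> K f l x l1 mf fK; have K0 := decay_ge0 fK.
have l0 : 0 < l by rewrite (lt_le_trans _ l1).
have [ig Eg] := gauss_integral x l0.
have -> : C * 2 ^+ p * Num.sqrt (pi *+ 2) * K / l * wt p x =
    \int[mu]_y (C * 2 ^+ p * K * wt p x * expR (- (l * (x - y)) ^+ 2 / 2)).
  by rewrite RintegralZl// Eg; ring.
apply: dominated_Rintegral.
- by apply: measurable_funM => //; exact: measurable_gauss.
- by apply: integrableZl ig.
move=> y; rewrite normrM ger0_norm ?expR_ge0//.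
have e1 : expR (- (l * (x - y)) ^+ 2) <=
    C * 2 ^+ p * wt p (x - y) * expR (- (l * (x - y)) ^+ 2 / 2).
  apply: (@le_trans _ _ (expR (- (2^-1 * (x - y)) ^+ 2) *
                         expR (- (l * (x - y)) ^+ 2 / 2))).
    rewrite -expRD ler_expR !exprMn; have := sqr_ge0 (x - y).
    have : 1 <= l ^+ 2 by rewrite exprn_ege1.
    set z := (x - y) ^+ 2; set L := l ^+ 2 => L1 z0.
    have : z <= L * z by rewrite ler_peMl.
    by lra.
  rewrite ler_wpM2r ?expR_ge0// (le_trans (CP _))// -mulrA ler_wpM2l ?(ltW C0)//.
  have := @wt_scale R p 2^-1 (x - y); rewrite exprVn invrK; apply.
  - by rewrite invr_gt0.
  - by rewrite invf_le1// ler1n.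
apply: (le_trans (ler_pM (expR_ge0 _) (normr_ge0 _) e1 (fK y))).
set g := expR _.
have -> : C * 2 ^+ p * wt p (x - y) * g * (K * wt p y) =
  C * 2 ^+ p * K * (wt p (x - y) * wt p y) * g by ring.
rewrite ler_wpM2r ?expR_ge0// ler_wpM2l ?wt_triangle//.
by rewrite !mulr_ge0 ?(ltW C0).
Qed.

(** A Gaussian of width 1/l decays like l^-p [wt p (x - y)]; the two additional powers in the bound
    on f make the y-integral converge. *)
Lemma gconv_le_small p : exists2 C : R, 0 <= C & forall K f l x, 0 < l -> l <= 1 ->
  measurable_fun setT f -> (forall y, `|f y| <= K * wt (p + 2) y) ->
  `|gconv l f x| <= C * K * l ^- p * wt p x.
Proof.
have [C C0 CP] := gauss_le_wt R p.
exists (C * \int[mu]_y wt 2 y).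
  by rewrite mulr_ge0 ?(ltW C0)// Rintegral_ge0// => y _; exact: wt_ge0.
move=> K f l x l0 l1 mf fK; have K0 := decay_ge0 fK.
have -> : C * (\int[mu]_y wt 2 y) * K * l ^- p * wt p x =
    \int[mu]_y (C * K * l ^- p * wt p x * wt 2 y).
  by rewrite RintegralZl//; [ring|exact: integrable_wt2].
apply: dominated_Rintegral.
- by apply: measurable_funM => //; exact: measurable_gauss.
- exact: integrable_wt2Z.
move=> y; rewrite normrM ger0_norm ?expR_ge0//.
have e1 : expR (- (l * (x - y)) ^+ 2) <= C * (l ^- p * wt p (x - y)).
  by rewrite (le_trans (CP _))// ler_wpM2l ?(ltW C0)// wt_scale.
apply: (le_trans (ler_pM (expR_ge0 _) (normr_ge0 _) e1 (fK y))).
rewrite wtD.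
have -> : C * (l ^- p * wt p (x - y)) * (K * (wt p y * wt 2 y)) =
  C * K * l ^- p * (wt p (x - y) * wt p y) * wt 2 y by ring.
rewrite ler_wpM2r ?wt_ge0// ler_wpM2l ?wt_triangle//.
by rewrite !mulr_ge0 ?invr_ge0 ?exprn_ge0 ?(ltW C0) ?(ltW l0).
Qed.

Lemma measurable_poly (Q : {poly R}) : measurable_fun setT (horner Q).
Proof. by apply: continuous_measurable_fun; exact: continuous_horner. Qed.

Lemma poly_mul_integrable (Q : {poly R}) f K n : measurable_fun setT f ->
  (size Q + 2 <= n)%N -> (forall y, `|f y| <= K * wt n y) ->
  mu.-integrable setT (EFin \o (fun y => Q.[y] * f y)).
Proof.
move=> mf sn fK; have [C C0 CP] := poly_le_onenorm Q.
apply: (@dominated_integrable _ _ R mu _ (fun y => (C * K) * wt 2 y)).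
- by apply: measurable_funM => //; exact: measurable_poly.
- exact: integrable_wt2Z.
move=> y; rewrite normrM.
apply: (le_trans (ler_pM _ _ (CP y) (decay_le sn fK y))) => //.
by rewrite wtD mulrACA (mulrA (_ ^+ _)) wtVK mul1r.
Qed.

(** Vanishing moments allow a Taylor polynomial of the Gaussian to be subtracted under the integral.
    The remainder gains l^M, and its growth (1+|y|)^(M+p) is absorbed by the decay of f. *)
Lemma gconv_le_moment p M : exists2 C : R, 0 <= C &
  forall K f l x, 0 < l -> l <= 1 ->
  measurable_fun setT f -> (forall y, `|f y| <= K * wt (M + p + 2) y) ->
  vanishing_moments f ->
  `|gconv l f x| <= C * K * l ^+ M * l ^- p * wt p x.
Proof.
have [C C0 CP] := @gauss_taylor R M p.
exists (C * \int[mu]_y wt 2 y).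
  by rewrite mulr_ge0// Rintegral_ge0// => y _; exact: wt_ge0.
move=> K f l x l0 l1 mf fK f0; have K0 := decay_ge0 fK.
have [Q sQ QP] := CP l x l0 l1.
have -> : gconv l f x = \int[mu]_y ((expR (- (l * (x - y)) ^+ 2) - Q.[y]) * f y).
  under eq_Rintegral => y _ do rewrite mulrBl.
  rewrite RintegralB//.
  - by rewrite f0 subr0.
  - by apply: (@gconv_integrable l f x K) => //; apply: decay_le fK; rewrite leq_addl.
  - by apply: poly_mul_integrable fK => //; rewrite leq_add2r (leq_trans sQ)// leq_addr.
have -> : C * (\int[mu]_y wt 2 y) * K * l ^+ M * l ^- p * wt p x =
    \int[mu]_y (C * l ^+ M * l ^- p * wt p x * K * wt 2 y).
  by rewrite RintegralZl//; [ring|exact: integrable_wt2].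
apply: dominated_Rintegral.
- apply: measurable_funM => //; apply: measurable_funB; first exact: measurable_gauss.
  exact: measurable_poly.
- exact: integrable_wt2Z.
move=> y; rewrite normrM.
apply: (le_trans (ler_pM (normr_ge0 _) (normr_ge0 _) (QP y) (fK y))).
by rewrite (wtD (M + p)) mulrACA (mulrA (_ ^+ _)) wtVK mul1r.
Qed.

Lemma gconv_shift l f x s : measurable_fun setT f ->
  gconv l f (x + s) = gconv l (fun y => f (y + s)) x.
Proof.
move=> mf; rewrite /gconv.
rewrite -(@Rintegral_shift R (fun y => expR (- (l * (x + s - y)) ^+ 2) * f y) s).
  by apply: eq_Rintegral => y _; rewrite opprD addrACA subrr addr0.
by apply: measurable_funM => //; exact: measurable_gauss.
Qed.

Lemma gconvB l f g x K L : measurable_fun setT f -> measurable_fun setT g ->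
  (forall y, `|f y| <= K * wt 2 y) -> (forall y, `|g y| <= L * wt 2 y) ->
  gconv l (fun y => f y - g y) x = gconv l f x - gconv l g x.
Proof.
move=> mf mg fK gL; rewrite /gconv -RintegralB//.
- by apply: eq_Rintegral => y _; rewrite mulrBr.
- exact: gconv_integrable fK.
- exact: gconv_integrable gL.
Qed.

Lemma measurable_shift f (s : R) : measurable_fun setT f ->
  measurable_fun setT (fun y : R => f (y + s)).
Proof. by move=> mf; apply: measurableT_comp => //; exact: measurable_funD. Qed.

Lemma vanishing_moments_shift f s : measurable_fun setT f ->
  vanishing_moments f -> vanishing_moments (fun y => f (y + s)).
Proof.
move=> mf f0 Q; rewrite -(f0 (Q \Po ('X - s%:P))).
rewrite -(@Rintegral_shift R (fun y => (Q \Po ('X - s%:P)).[y] * f y) s).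
  by apply: eq_Rintegral => y _; rewrite horner_comp !hornerE addrK.
by apply: measurable_funM => //; exact: measurable_poly.
Qed.

End gauss_convolution.

(** * Integrals of tensor products *)

Section product_integral.
Context d1 d2 (T1 : measurableType d1) (T2 : measurableType d2) (R : realType).
Variable m1 : {sigma_finite_measure set T1 -> \bar R}.
Variable m2 : {sigma_finite_measure set T2 -> \bar R}.
Variables (f : T1 -> R) (g : T2 -> R).
Hypothesis if_ : m1.-integrable setT (EFin \o f).
Hypothesis ig : m2.-integrable setT (EFin \o g).

Let mf : measurable_fun setT f.
Proof. exact/measurable_EFinP/(measurable_int m1). Qed.

Let mg : measurable_fun setT g.
Proof. exact/measurable_EFinP/(measurable_int m2). Qed.

Lemma tensor_integrable :
  (m1 \x m2)%E.-integrable setT (fun z => (f z.1 * g z.2)%:E).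
Proof.
apply/integrable12ltyP => /=.
  apply/measurable_EFinP; apply: measurable_funM; exact: measurableT_comp.
under eq_integral => x _.
  under eq_integral => y _ do rewrite normrM EFinM.
  rewrite ge0_integralZl//; last by apply/measurable_EFinP; exact: measurableT_comp.
  over.
rewrite /= ge0_integralZr//.
- by case/integrableP: if_ => _ /= foo; case/integrableP: ig => _ /= goo;
    rewrite lte_mul_pinfty ?integral_ge0 ?ge0_fin_numE ?integral_ge0.
- by apply/measurable_EFinP; exact: measurableT_comp.
- exact: integral_ge0.
Qed.

Lemma Rintegral_tensor : \int[(m1 \x m2)%E]_z (f z.1 * g z.2) =
  \int[m1]_x f x * \int[m2]_y g y.
Proof.
rewrite /Rintegral -fineM ?integrable_fin_num//; congr fine.
rewrite -integral12_prod_meas1; last exact: tensor_integrable.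
transitivity (\int[m1]_x ((f x)%:E * \int[m2]_y (g y)%:E))%E.
  apply: eq_integral => x _; rewrite /fubini_F/= -integralZl//.
rewrite -[in LHS](fineK (integrable_fin_num measurableT ig)).
by rewrite integralZr// fineK// integrable_fin_num.
Qed.

End product_integral.

Section tuple_integral.
Variable R : realType.
Local Notation mu := (@lebesgue_measure R).

Lemma measurable_tuple_prod n (F : 'I_n -> R -> R) :
  (forall i, measurable_fun setT (F i)) ->
  measurable_fun setT (fun y : n.-tuple R => \prod_(i < n) F i (tnth y i)).
Proof.
move=> mF; apply: measurable_prod => i _.
by apply: measurableT_comp => //; exact: measurable_tnth.
Qed.

(** Induction on n: [lebesgue_tuple] is the image of a product measure under [tuple_cons], along
    which the integrand splits into its first factor and the rest. For n = 0 the measure is a unit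
    mass and the product is empty. *)
Lemma tuple_prod_integrable n (F : 'I_n -> R -> R) :
  (forall i, mu.-integrable setT (EFin \o F i)) ->
  (@lebesgue_tuple R n).-integrable setT
    (fun y => (\prod_(i < n) F i (tnth y i))%:E) /\
  \int[@lebesgue_tuple R n]_y (\prod_(i < n) F i (tnth y i)) =
  \prod_(i < n) \int[mu]_x F i x.
Proof.
elim: n F => [|n IH] F iF.
  have E (h : 0.-tuple R -> \bar R) : measurable_fun setT h ->
      (\int[@lebesgue_tuple R 0]_y h y = h [tuple])%E.
    move=> mh; transitivity (\int[\d_([tuple] : 0.-tuple R)]_y h y)%E.
      exact: eq_measure_integral.
    by rewrite integral_dirac// diracT mul1e.
  have m1 : measurable_fun setT
      (fun y : 0.-tuple R => (\prod_(i < 0) F i (tnth y i))%:E).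
    by apply/measurable_EFinP; apply: measurable_tuple_prod => -[].
  split; last by rewrite /Rintegral E// !big_ord0.
  apply/integrableP; split => //; rewrite E /=.
    by rewrite ltry.
  by do 2 apply: measurableT_comp => //; exact/measurable_EFinP.
have mF i : measurable_fun setT (F i) by case/integrableP: (iF i) => /measurable_EFinP.
have [iG EG] := IH (fun i => F (lift ord0 i)) (fun i => iF _).
pose G (t : n.-tuple R) := \prod_(i < n) F (lift ord0 i) (tnth t i).
pose h (y : n.+1.-tuple R) := \prod_(i < n.+1) F i (tnth y i).
have hE p : h (tuple_cons p) = F ord0 p.1 * G p.2.
  by rewrite /h big_ord_recl tnth0; congr (_ * _); apply: eq_bigr => i _; rewrite tnthS.
have mh : measurable_fun setT h by exact: measurable_tuple_prod.
pose nu := measure_function_pushforward__canonical__measure_function_Measure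
    (mu \x @lebesgue_tuple R n)%E (@measurable_tuple_cons R n).
have nuE A : measurable A -> A `<=` setT -> @lebesgue_tuple R n.+1 A = nu A by [].
have ih : (mu \x @lebesgue_tuple R n)%E.-integrable setT ((EFin \o h) \o @tuple_cons R n).
  rewrite (_ : _ \o _ = fun p => (F ord0 p.1 * G p.2)%:E).
    exact: (tensor_integrable (iF ord0) iG).
  by apply/funext => p /=; rewrite hE.
have mEh : measurable_fun setT (EFin \o h) by exact/measurable_EFinP.
split.
  apply/integrableP; split; first exact: mEh.
  rewrite (eq_measure_integral nu)//.
  have := integrable_pushforward (@measurable_tuple_cons R n) mEh ih measurableT.
  by case/integrableP.
rewrite big_ord_recl -EG -(Rintegral_tensor (iF ord0) iG).
rewrite /Rintegral (eq_measure_integral nu)//.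
rewrite (integral_pushforward (@measurable_tuple_cons R n) mEh ih measurableT).
by congr fine; apply: eq_integral => p _ /=; rewrite hE.
Qed.

End tuple_integral.

(** * Subordination of powers to Gaussians *)

Section subordination_kernel.
Variable R : realType.
Local Notation mu := (@lebesgue_measure R).
Implicit Types (a b v w r : R).

(** The Gamma-type integrand u^(a-1) (e^{-ur} - b) du after the substitution u = e^v, which turns
    rescaling of r into translation of v. *)
Definition subord a b v r : R := expR (a * v) * (expR (- (expR v * r)) - b).

(* The values for which [subord a b v r] is integrable in v: subtracting b = 1
   improves the decay at v = -oo to e^{(a+1)v} but forces a < 0 at v = +oo.  The
   first case serves d >= 2, the second d = 1. *)
Definition admissible a b := (b = 0 /\ 0 < a) \/ (b = 1 /\ -1 < a < 0).

Lemma subord_scale a b v w :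
  subord a b v (expR w) = expR (- a * w) * subord a b (v + w) 1.
Proof.
by rewrite /subord mulr1 mulrA -expRD -expRD; congr (expR _ * _); ring.
Qed.

Lemma expRN_decay (c : R) p : 0 < c -> exists2 C : R, 0 < C &
  forall v, expR (- (c * `|v|)) <= C * wt p v.
Proof.
move=> c0; have [C C0 CP] := expRN_le_wt R p.
pose e := Num.min c 1; have e0 : 0 < e by rewrite lt_min c0 ltr01.
have e1 : e <= 1 by rewrite ge_min lexx orbT.
exists (C * e ^- p) => [|v]; first by rewrite mulr_gt0// invr_gt0 exprn_gt0.
apply: (@le_trans _ _ (expR (- `|e * v|))).
  rewrite ler_expR lerN2 normrM (gtr0_norm e0) ler_wpM2r//.
  by rewrite ge_min lexx.
by rewrite (le_trans (CP _))// -mulrA ler_wpM2l ?(ltW C0)// wt_scale.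
Qed.

Lemma expRN_decay2 (c c' : R) (h : R -> R) : 0 < c -> 0 < c' ->
  (exists2 A, 0 <= A & forall v, 0 <= v -> `|h v| <= A * expR (- (c * v))) ->
  (exists2 A, 0 <= A & forall v, v <= 0 -> `|h v| <= A * expR (c' * v)) ->
  exists2 C, 0 < C & forall v, `|h v| <= C * wt 2 v.
Proof.
move=> c0 c'0 [A A0 AP] [A' A'0 AP'].
have [C C0 CP] := expRN_decay 2 c0; have [C' C'0 CP'] := expRN_decay 2 c'0.
exists (A * C + A' * C' + 1) => [|v].
  by rewrite ltr_wpDl ?addr_ge0 ?mulr_ge0 ?(ltW C0) ?(ltW C'0).
have [v0|/ltW v0] := leP 0 v.
  apply: le_trans (AP v v0) _.
  apply: (@le_trans _ _ (A * C * wt 2 v)).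
    by rewrite -mulrA ler_wpM2l// (le_trans _ (CP v))// ger0_norm.
  rewrite ler_wpM2r ?wt_ge0// -addrA lerDl.
  by rewrite addr_ge0 ?mulr_ge0 ?(ltW C'0).
apply: le_trans (AP' v v0) _.
apply: (@le_trans _ _ (A' * C' * wt 2 v)).
  by rewrite -mulrA ler_wpM2l// (le_trans _ (CP' v))// ler0_norm// mulrN opprK.
rewrite ler_wpM2r ?wt_ge0// -addrA addrCA lerDl.
by rewrite addr_ge0 ?mulr_ge0 ?(ltW C0).
Qed.

(** With z = e^v r, 1 - e^{-z} <= min(1, z) <= min(1, e^v) (1+r). The remaining factor e^{av} min(1,
    e^v) decays at +oo because a < 0 and at -oo because a+1 > 0. *)
Lemma subord1_le a : -1 < a < 0 -> exists2 C, 0 < C &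
  forall v r, 0 <= r -> `|subord a 1 v r| <= C * wt 2 v * (1 + r).
Proof.
move=> /andP[a1 a0].
pose h v := expR (a * v) * Num.min 1 (expR v).
have h0 v : 0 <= h v by rewrite mulr_ge0 ?expR_ge0// le_min ler01 expR_ge0.
have [||||C C0 CP] := @expRN_decay2 (- a) (a + 1) h.
- by rewrite oppr_gt0.
- by rewrite -ltrBlDr sub0r.
- exists 1 => // v v0; rewrite mul1r ger0_norm// mulNr opprK.
  by rewrite ler_piMr ?expR_ge0// ge_min lexx.
- exists 1 => // v v0; rewrite mul1r ger0_norm// mulrDl mul1r expRD.
  by rewrite ler_wpM2l ?expR_ge0// ge_min lexx orbT.
exists C => // v r r0.
apply: (@le_trans _ _ (h v * (1 + r))); last first.
  by rewrite ler_wpM2r ?addr_ge0// (le_trans (ler_norm _)).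
rewrite normrM ger0_norm ?expR_ge0// -mulrA ler_wpM2l ?expR_ge0//.
have e0 := expR_gt0 v.
have er0 : 0 <= expR v * r by rewrite mulr_ge0 ?(ltW e0).
rewrite ler0_norm; last first.
  by rewrite subr_le0 -[leRHS]expR0 ler_expR oppr_le0.
rewrite opprB; have := expR_ge1Dx (- (expR v * r)).
have := expR_gt0 (- (expR v * r)); rewrite /Num.min.
by case: (ltP 1 (expR v)) => _ ? ?; lra.
Qed.

Lemma subord_le a b : admissible a b ->
  exists2 C, 0 < C & forall v, `|subord a b v 1| <= C * wt 2 v.
Proof.
case=> -[-> ha]; last first.
  have [C C0 CP] := subord1_le ha; exists (C * 2) => [|v]; first by rewrite mulr_gt0.
  by rewrite (le_trans (CP v 1 ler01))// -!mulrA ler_wpM2l ?(ltW C0)// mulrC.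
apply: (@expRN_decay2 1 a) => //.
  (* The exponential of the maximum of (a+1)v - e^v, attained at v = ln(a+1). *)
  exists (expR ((a + 1) * ln (a + 1) - (a + 1))) => [|v v0]; first exact: expR_ge0.
  have a10 : 0 < a + 1 by rewrite addr_gt0.
  rewrite /subord subr0 mulr1 -!expRD ger0_norm ?expR_ge0// ler_expR mul1r.
  have := expR_ge1Dx (v - ln (a + 1)) => /(ler_wpM2l (ltW a10)).
  rewrite expRD expRN lnK ?posrE// mulrCA divff ?gt_eqF// mulr1.
  by set L := ln _; nra.
exists 1 => // v v0; rewrite mul1r /subord subr0 mulr1 normrM ger0_norm ?expR_ge0//.
by rewrite ler_piMr ?expR_ge0// ger0_norm ?expR_ge0// -[leRHS]expR0 ler_expR oppr_le0 expR_ge0.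
Qed.

Lemma measurable_subord a b r : measurable_fun setT (fun v => subord a b v r).
Proof.
apply: measurable_funM; first by apply: measurableT_comp => //; exact: measurable_funM.
apply: measurable_funB => //; apply: measurableT_comp => //.
by apply: measurableT_comp => //; exact: measurable_funM.
Qed.

Lemma subord_integrable a b : admissible a b ->
  mu.-integrable setT (EFin \o (fun v => subord a b v 1)).
Proof.
move=> /subord_le[C C0 CP].
apply: (@dominated_integrable _ _ R mu _ (fun v => C * wt 2 v)) => //.
  exact: measurable_subord.
exact: integrable_wt2Z.
Qed.

(** In both admissible cases this is Gamma(a), continued to -1 < a < 0 when b = 1. *)
Definition subord_const a b := \int[mu]_v subord a b v 1.

(** A nonnegative function of integral 0 vanishes almost everywhere; for a positive one the whole
    line would be a null set. *)
Lemma Rintegral_gt0 (h : R -> R) : mu.-integrable setT (EFin \o h) ->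
  (forall v, 0 < h v) -> 0 < \int[mu]_v h v.
Proof.
move=> ih h0; have mh : measurable_fun setT h.
  by case/integrableP: ih => /measurable_EFinP.
rewrite lt_neqAle Rintegral_ge0 ?andbT; last by move=> v _; exact: ltW.
apply/eqP => E.
have : (\int[mu]_v `|(h v)%:E| = 0)%E.
  under eq_integral => v _ do rewrite gee0_abs ?lee_fin ?(ltW (h0 v))//.
  transitivity (\int[mu]_v h v)%:E; last by rewrite -E.
  by rewrite fineK//; exact: integrable_fin_num ih.
move=> /(@ae_eq_integral_abs _ _ _ mu setT measurableT (EFin \o h)
  (proj2 (measurable_EFinP _ _) mh)) [N [mN N0 sN]].
have NT : N = setT.
  apply/seteqP; split => // v _; apply: sN => /(_ I)/= [] /eqP.
  by rewrite gt_eqF.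
have := @lebesgue_measure_itv R `]-oo, +oo[.
by rewrite set_itvNyy -NT N0.
Qed.

(** The integrand has constant sign: positive for b = 0, negative for b = 1. *)
Lemma subord_const_neq0 a b : admissible a b -> subord_const a b != 0.
Proof.
move=> ab; have i1 := subord_integrable ab.
case: (ab) => -[b01 ha].
  rewrite gt_eqF// Rintegral_gt0// => v.
  by rewrite /subord b01 subr0 mulr_gt0 ?expR_gt0.
rewrite -oppr_eq0 -mulN1r /subord_const -RintegralZl// gt_eqF// Rintegral_gt0//.
  by apply: integrableZl i1.
move=> v; rewrite mulN1r oppr_gt0 /subord b01 pmulr_rlt0 ?expR_gt0// subr_lt0.
by rewrite -[ltRHS]expR0 ltr_expR oppr_lt0 mulr1 expR_gt0.
Qed.

(** Translating v by ln r reduces the integral to r = 1 and releases the factor r^-a, written as an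
    exponential. *)
Lemma integral_subord a b r : admissible a b -> 0 < r ->
  mu.-integrable setT (EFin \o (fun v => subord a b v r)) /\
  \int[mu]_v subord a b v r = subord_const a b * expR (- a * ln r).
Proof.
move=> ab r0; have i1 := subord_integrable ab.
have m1 := measurable_subord a b 1.
have E : (fun v => subord a b v r) =
    (fun v => expR (- a * ln r) * subord a b (v + ln r) 1).
  by apply/funext => v; rewrite -subord_scale lnK.
have i2 : mu.-integrable setT (EFin \o (fun v => subord a b (v + ln r) 1)).
  apply/integrableP; split.
    by apply/measurable_EFinP; exact: (measurable_shift (f := (subord a b)^~ 1)).
  case/integrableP: i1 => _.
  rewrite -(@integral_shift _ (fun v => `|(subord a b v 1)%:E|%E) (ln r))//.
  by do 2 apply: measurableT_comp => //; exact/measurable_EFinP.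
rewrite E; split; first by apply: integrableZl i2.
by rewrite RintegralZl// mulrC (Rintegral_shift (f := (subord a b)^~ 1)).
Qed.

End subordination_kernel.

(** * Riesz kernels as mixtures of Gaussians *)

Section tuple_subordination.
Variable R : realType.
Local Notation mu := (@lebesgue_measure R).
Local Notation leb n := (@lebesgue_tuple R n).

Definition normsq n (x : n.-tuple R) : R := \sum_(i < n) tnth x i ^+ 2.

Lemma normsq_ge0 n (x : n.-tuple R) : 0 <= normsq x.
Proof. by apply: sumr_ge0 => i _; exact: sqr_ge0. Qed.

Lemma normsq_sub_eq0 n (x y : n.-tuple R) : (normsq (tuple_sub x y) == 0) = (y == x).
Proof.
rewrite psumr_eq0 => [|i _]; last exact: sqr_ge0.
apply/allP/eqP => [xy|-> i _].
  apply: eq_from_tnth => i; have := xy i (mem_index_enum _).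
  by rewrite sqrf_eq0 tnth_mktuple subr_eq0 => /eqP.
by rewrite tnth_mktuple subrr expr0n eqxx.
Qed.

Lemma measurable_normsq_sub n (x : n.-tuple R) :
  measurable_fun setT (fun y => normsq (tuple_sub x y)).
Proof.
apply: measurable_sum => i; apply: measurable_funX.
under eq_fun do rewrite tnth_mktuple.
by apply: measurable_funB => //; exact: measurable_tnth.
Qed.

Lemma lebesgue_tuple_set1 n (x : n.-tuple R) : (0 < n)%N ->
  measurable [set x] /\ leb n [set x] = 0%E.
Proof.
case: n x => // n x _.
pose F i := \1_[set tnth x i] : R -> R.
have F0 i : mu.-integrable setT (EFin \o F i) /\ \int[mu]_y F i y = 0.
  have z : (\int[mu]_y (F i y)%:E = 0)%E.
    by rewrite integral_indic// setIT; exact: lebesgue_measure_set1.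
  split; last by rewrite /Rintegral z.
  apply/integrableP; split.
    by apply/measurable_EFinP; exact: measurable_indic.
  under eq_integral => y _ do rewrite gee0_abs ?lee_fin//.
  by rewrite z.
have [ih hE] := tuple_prod_integrable (fun i => (F0 i).1).
set h := fun y : n.+1.-tuple R => \prod_(i < n.+1) F i (tnth y i) in ih hE.
have h1 : h = \1_[set x].
  apply/funext => y; rewrite /h indicE in_set1; case: eqVneq => [->|yx].
    by rewrite big1// => i _; rewrite /F indicE in_set1 eqxx.
  have [i xyi] : exists i, tnth y i != tnth x i.
    apply/existsP; rewrite -negb_forall; apply: contra yx => /forallP yx.
    by apply/eqP/eq_from_tnth => i; exact/eqP.
  by rewrite (bigD1 i)//= /F indicE in_set1 (negbTE xyi) mul0r.
have mx : measurable [set x].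
  have mh : measurable_fun setT h by case/integrableP: ih => /measurable_EFinP.
  rewrite (_ : [set x] = setT `&` h @^-1` [set 1]); first exact: mh.
  rewrite setTI h1; apply/seteqP; split => y /=; rewrite indicE in_set1.
    by move=> ->; rewrite eqxx.
  by case: eqVneq => // _ /eqP; rewrite eq_sym oner_eq0.
split=> //; have : (\int[leb n.+1]_y (h y)%:E = 0)%E.
  transitivity (\int[leb n.+1]_y h y)%:E.
    by rewrite fineK//; exact: integrable_fin_num ih.
  by rewrite hE big_ord_recl (F0 _).2 mul0r.
by rewrite h1 integral_indic// setIT.
Qed.

Lemma powR_norm2 n (x : n.-tuple R) (a : R) : 0 < normsq x ->
  norm2 x `^ (- (2 * a)) = expR (- a * ln (normsq x)).
Proof.
move=> x0; have s0 : 0 < norm2 x by rewrite sqrtr_gt0.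
rewrite /powR gt_eqF//; congr expR.
rewrite -[in RHS](sqr_sqrtr (ltW x0)) lnXn//.
by rewrite -/(norm2 x) mulrnAr -mulr_natr; ring.
Qed.

(** Fubini in (y, v). The assumed bound, integrable in v, gives integrability on the product; the
    inner v-integral is a multiple of the power of the distance for every y other than x, hence
    almost everywhere. *)
Lemma subordination n (a b : R) (f : n.-tuple R -> R) (x : n.-tuple R) (C : R) :
  (0 < n)%N -> admissible a b -> measurable_fun setT f ->
  (forall v, \int[leb n]_y `|(subord a b v (normsq (tuple_sub x y)) * f y)%:E| <=
     (C * wt 2 v)%:E)%E ->
  let G v := \int[leb n]_y (subord a b v (normsq (tuple_sub x y)) * f y) in
  mu.-integrable setT (EFin \o G) /\
  \int[leb n]_y (subord_const a b * (norm2 (tuple_sub x y) `^ (- (2 * a)) * f y)) =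
  \int[mu]_v G v.
Proof.
move=> n0 ab mf Hdom G.
pose F (z : n.-tuple R * measurableTypeR R) :=
  (subord a b z.2 (normsq (tuple_sub x z.1)) * f z.1)%:E.
have msnd : measurable_fun [set: n.-tuple R * measurableTypeR R] (fun z => z.2 : R).
  exact: measurable_snd.
have mr : measurable_fun [set: n.-tuple R * measurableTypeR R]
    (fun z => normsq (tuple_sub x z.1)).
  apply: (measurableT_comp (measurable_normsq_sub x)); exact: measurable_fst.
have mF : measurable_fun setT F.
  apply/measurable_EFinP; apply: measurable_funM; last first.
    by apply: measurableT_comp => //; exact: measurable_fst.
  apply: measurable_funM.
    apply: (@measurableT_comp _ _ _ _ _ _ (@expR R)) => //.
    exact: (measurable_funM (measurable_cst a) msnd).
  apply: measurable_funB => //.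
  apply: (@measurableT_comp _ _ _ _ _ _ (@expR R)) => //.
  apply: measurableT_comp => //; apply: measurable_funM => //.
  exact: measurableT_comp.
have iF : (leb n \x mu)%E.-integrable setT F.
  apply/integrable21ltyP => //.
  have := integrable_lty measurableT (integrable_wt2Z C).
  apply: le_lt_trans; apply: ge0_le_integral => //.
  - by move=> v _; exact: integral_ge0.
  - apply: (measurable_fun_fubini_tonelli_G (abse \o F)).
      exact: measurableT_comp.
    by move=> z /=; rewrite lee_fin.
  - by apply/measurable_EFinP; apply: measurable_funM => //; exact: measurable_wt.
  - by move=> v _; exact: Hdom.
have iFv v : (leb n).-integrable setT (fun y => F (y, v)).
  apply/integrableP; split; last by rewrite (le_lt_trans (Hdom v))// ltry.
  by apply: measurableT_comp => //; exact: measurable_pair2.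
have GE v : (\int[leb n]_y F (y, v) = (G v)%:E)%E.
  by rewrite fineK//; exact: integrable_fin_num (iFv v).
split.
  apply: (@dominated_integrable _ _ R mu _ (fun v => C * wt 2 v)).
  - apply/measurable_EFinP; rewrite (_ : _ \o _ = fubini_G (leb n) F).
      exact: measurable_fubini_G iF.
    by apply/funext => v; rewrite /fubini_G GE.
  - exact: integrable_wt2Z.
  - move=> v; rewrite -lee_fin; apply: le_trans (Hdom v).
    rewrite EFin_normr_Rintegral//; last exact: iFv.
    by apply: le_abse_integral => //; case/integrableP: (iFv v).
rewrite /Rintegral; congr fine.
transitivity (\int[mu]_v \int[leb n]_y F (y, v))%E; last first.
  by apply: eq_integral => v _; rewrite GE.
rewrite -Fubini//; have [mx x0] := lebesgue_tuple_set1 x n0.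
have mFF := measurable_fubini_F iF.
have aeE y : y != x -> (subord_const a b * (norm2 (tuple_sub x y) `^ (- (2 * a)) * f y))%:E =
   (\int[mu]_v F (y, v))%E.
  move=> yx; have r0 : 0 < normsq (tuple_sub x y).
    by rewrite lt_neqAle normsq_ge0 eq_sym normsq_sub_eq0 yx.
  have [iS SE] := integral_subord ab r0.
  rewrite powR_norm2// mulrA -SE -RintegralZr// fineK//.
  by apply: integrable_fin_num => //; apply: integrableZr iS.
apply: ae_eq_integral => //; last first.
  exists [set x]; split => // y /= H; apply: contra_notP H => /eqP yx _.
  exact: aeE.
apply/measurable_EFinP.
apply: measurable_funM => //; apply: measurable_funM => //.
apply: (measurableT_comp (measurable_powR _)).
apply: (measurableT_comp _ (measurable_normsq_sub x)).
by apply: continuous_measurable_fun; exact: sqrt_continuous.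
Qed.

End tuple_subordination.

(** * Elementary inequalities for finite products *)

Section finite_products.
Variable R : realDomainType.

Lemma sum_le_prod (I : Type) (r : seq I) (c : I -> R) : (forall i, 0 <= c i) ->
  1 + \sum_(i <- r) c i <= \prod_(i <- r) (1 + c i).
Proof.
move=> c0; elim: r => [|i r IH]; first by rewrite !big_nil addr0.
rewrite !big_cons; have c1 : 0 <= 1 + c i by rewrite addr_ge0.
apply: le_trans (ler_wpM2l c1 IH).
rewrite mulrDr mulr1 addrA lerD2l mulrDl mul1r lerDl.
by rewrite mulr_ge0// sumr_ge0.
Qed.

(** Telescoping: the factors are exchanged one at a time, each exchange costing s times the product
    of the bounds. *)
Lemma prod_diff_le n (A B U : 'I_n -> R) (s : R) :
  (forall i, `|A i| <= U i) -> (forall i, `|B i| <= U i) ->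
  (forall i, `|A i - B i| <= s * U i) ->
  `|\prod_(i < n) A i - \prod_(i < n) B i| <= n%:R * s * \prod_(i < n) U i.
Proof.
elim: n A B U => [|n IH] A B U AU BU ABU.
  by rewrite !big_ord0 subrr normr0 !mul0r.
have U0 i : 0 <= U i by rewrite (le_trans _ (AU i)).
rewrite !big_ord_recl.
set PA := \prod_(i < n) A _; set PB := \prod_(i < n) B _; set PU := \prod_(i < n) U _.
have PBU : `|PB| <= PU by rewrite normr_prod ler_prod// => i _; rewrite normr_ge0 BU.
have -> : A ord0 * PA - B ord0 * PB = A ord0 * (PA - PB) + (A ord0 - B ord0) * PB by ring.
apply: le_trans (ler_normD _ _) _; rewrite !normrM.
apply: (@le_trans _ _ (U ord0 * (n%:R * s * PU) + s * U ord0 * PU)).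
  by apply: lerD; apply: ler_pM => //; exact: IH.
by rewrite -[n.+1%:R]natr1 le_eqVlt; apply/orP; left; apply/eqP; ring.
Qed.

End finite_products.

(** * Gaussian mixtures integrated against tensor products *)

Section tensor.
Variable R : realType.
Local Notation mu := (@lebesgue_measure R).
Local Notation leb n := (@lebesgue_tuple R n).

Definition tensor n (fs : 'I_n -> R -> R) (y : n.-tuple R) : R :=
  \prod_(i < n) fs i (tnth y i).

Lemma expR_half_sqr (v z : R) : (expR (v / 2) * z) ^+ 2 = expR v * z ^+ 2.
Proof. by rewrite exprMn -expRM_natl [2 * _]mulrC divfK. Qed.

(** The Gaussian of a squared norm factorises over the coordinates; its inverse width is l =
    e^{v/2}. *)
Lemma subord_tensorE n (fs : 'I_n -> R -> R) (a b v : R) (x y : n.-tuple R) :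
  subord a b v (normsq (tuple_sub x y)) * tensor fs y =
  expR (a * v) * (tensor (fun i z =>
     expR (- (expR (v / 2) * (tnth x i - z)) ^+ 2) * fs i z) y - b * tensor fs y).
Proof.
rewrite /tensor big_split/= -mulrA -mulrBl; congr (_ * ((_ - _) * _)).
rewrite -expR_sum; congr expR; rewrite /normsq mulr_sumr -sumrN.
by apply: eq_bigr => i _; rewrite expR_half_sqr tnth_mktuple.
Qed.

Lemma decay_integrable (f : R -> R) K : measurable_fun setT f ->
  (forall y, `|f y| <= K * wt 2 y) -> mu.-integrable setT (EFin \o f).
Proof.
move=> mf fK; apply: (@dominated_integrable _ _ R mu _ (fun y => K * wt 2 y)) => //.
exact: integrable_wt2Z.
Qed.

Lemma Rintegral_subord_tensor n (fs : 'I_n -> R -> R) (K a b v : R) (x : n.-tuple R) :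
  (forall i, measurable_fun setT (fs i)) -> (forall i y, `|fs i y| <= K * wt 2 y) ->
  (leb n).-integrable setT
    (EFin \o (fun y => subord a b v (normsq (tuple_sub x y)) * tensor fs y)) /\
  \int[leb n]_y (subord a b v (normsq (tuple_sub x y)) * tensor fs y) =
  expR (a * v) * (\prod_(i < n) gconv (expR (v / 2)) (fs i) (tnth x i) -
                  b * \prod_(i < n) \int[mu]_y fs i y).
Proof.
move=> mfs fsK.
have [i1 e1] := tuple_prod_integrable
  (fun i => @gconv_integrable R (expR (v / 2)) (fs i) (tnth x i) K (mfs i) (fsK i)).
have [i2 e2] := tuple_prod_integrable (fun i => decay_integrable (mfs i) (fsK i)).
have i3 : (leb n).-integrable setT (EFin \o (fun y => b * tensor fs y)).
  by apply: integrableZl i2.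
have i4 := @integrableB _ _ _ (leb n) setT measurableT _ _ i1 i3.
rewrite (funext (fun y => subord_tensorE fs a b v x y)).
split; first by apply: integrableZl i4.
rewrite RintegralZl//; congr (_ * _).
by rewrite RintegralB// [X in _ - X]RintegralZl// e1 e2.
Qed.

(** This is the domination required for Fubini. It concerns absolute values, so no cancellation can
    help. *)
Lemma subord_tensor_le n (fs : 'I_n -> R -> R) (K a b : R) (x : n.-tuple R) :
  admissible a b -> (b = 0 -> a < n%:R / 2) ->
  (forall i, measurable_fun setT (fs i)) -> (forall i y, `|fs i y| <= K * wt 4 y) ->
  exists C, forall v,
  (\int[leb n]_y `|(subord a b v (normsq (tuple_sub x y)) * tensor fs y)%:E|
    <= (C * wt 2 v)%:E)%E.
Proof.
move=> ab an mfs fsK.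
have mt : measurable_fun setT (tensor fs) by exact: measurable_tuple_prod.
have ms v : measurable_fun setT (fun y => subord a b v (normsq (tuple_sub x y))).
  have : measurable_fun setT (fun r : R => subord a b v r).
    apply: measurable_funM => //; apply: measurable_funB => //.
    by apply: measurableT_comp => //; apply: measurableT_comp => //; exact: measurable_funM.
  by move=> m1; apply: (measurableT_comp m1); exact: measurable_normsq_sub.
have nt y : `|tensor fs y| = tensor (fun i z => `|fs i z|) y by rewrite normr_prod.
case: (ab) => -[b01 ha].
  (* For b = 0 the integral of absolute values is again a product of Gaussian convolutions. At +oo
     each of the n factors is O(e^{-v/2}), which beats e^{av} because a < n/2; at -oo the factors
     are bounded and e^{av} decays. *)
  pose h v := expR (a * v) * \prod_(i < n) gconv (expR (v / 2)) (fun z => `|fs i z|) (tnth x i).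
  have mfs' i : measurable_fun setT (fun z => `|fs i z|) by exact: measurableT_comp.
  have fsK' i y : `| `|fs i y| | <= K * wt 4 y by rewrite normr_id.
  have hE v : (\int[leb n]_y `|(subord a b v (normsq (tuple_sub x y)) * tensor fs y)%:E| =
      (h v)%:E)%E.
    have [i1 e1] := @Rintegral_subord_tensor n (fun i z => `|fs i z|) K a b v x mfs'
      (fun i => decay_le (isT : (2 <= 4)%N) (fsK' i)).
    rewrite b01 mul0r subr0 in e1; rewrite /h -e1 fineK; last first.
      by rewrite -b01; exact: integrable_fin_num i1.
    apply: eq_integral => y _; rewrite b01/= normrM nt ger0_norm//.
    by rewrite /subord subr0 mulr_ge0 ?expR_ge0.
  suff [C C0 CP] : exists2 C, 0 < C & forall v, `|h v| <= C * wt 2 v.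
    by exists C => v; rewrite hE lee_fin (le_trans (ler_norm _)).
  have [C C0 CP] := gconv_le_large R 2.
  have [D D0 DP] := gconv_le_small R 0.
  apply: (@expRN_decay2 R (n%:R / 2 - a) a) => //; first by rewrite subr_gt0 an.
    exists ((`|C * K|) ^+ n) => [|v v0]; first by rewrite exprn_ge0.
    rewrite normrM ger0_norm ?expR_ge0// normr_prod.
    have -> : expR (- ((n%:R / 2 - a) * v)) = expR (a * v) * (expR (- (v / 2))) ^+ n.
      by rewrite -expRM_natl -expRD; congr expR; ring.
    rewrite mulrCA ler_wpM2l ?expR_ge0// -exprMn.
    rewrite -[in leRHS](card_ord n) -prodr_const ler_prod// => i _.
    rewrite normr_ge0/=.
    have l1 : 1 <= expR (v / 2) by rewrite -[leLHS]expR0 ler_expR divr_ge0.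
    apply: le_trans (CP K _ _ (tnth x i) l1 (mfs' i) (decay_le (isT : (2 <= 4)%N) (fsK' i))) _.
    rewrite -expRN -mulrA ler_pM ?mulr_ge0 ?expR_ge0 ?wt_ge0//.
      exact: decay_ge0 (fsK i).
      by rewrite ler_norm.
    by rewrite ler_piMr ?expR_ge0// wt_le1.
  exists ((`|D * K|) ^+ n) => [|v v0]; first by rewrite exprn_ge0.
  rewrite normrM ger0_norm ?expR_ge0// normr_prod mulrC ler_wpM2r ?expR_ge0//.
  rewrite -[in leRHS](card_ord n) -prodr_const ler_prod// => i _.
  rewrite normr_ge0/=.
  have l1 : expR (v / 2) <= 1 by rewrite -[leRHS]expR0 ler_expR pmulr_lle0.
  apply: le_trans (DP K _ _ (tnth x i) (expR_gt0 _) l1 (mfs' i)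
    (decay_le (isT : (2 <= 4)%N) (fsK' i))) _.
  by rewrite /wt !expr0 invr1 !mulr1 ler_norm.
(* For b = 1 the kernel grows at most like 1+|x-y|^2, which is below the product of the
   1+(x_i-y_i)^2 and is absorbed by two of the four powers of decay of the factors. *)
have [C C0 CP] := subord1_le ha.
pose F i z := (1 + `|tnth x i|) ^+ 2 * (K * wt 2 z).
have iF i : mu.-integrable setT (EFin \o F i) by apply: integrableZl (integrable_wt2Z K).
have [i1 _] := tuple_prod_integrable iF.
exists (C * \int[leb n]_y tensor F y) => v.
have -> : (C * \int[leb n]_y tensor F y * wt 2 v)%:E =
    (\int[leb n]_y (C * wt 2 v * tensor F y)%:E)%E.
  under [RHS]eq_integral do rewrite EFinM.
  by rewrite integralZl// -[in RHS](fineK (integrable_fin_num measurableT i1)) mulrAC.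
apply: ge0_le_integral => //.
- by apply: measurableT_comp => //; apply/measurable_EFinP; exact: measurable_funM.
- apply/measurable_EFinP; apply: measurable_funM => //.
  by case/integrableP: i1 => /measurable_EFinP.
move=> y _; rewrite lee_fin b01 normrM nt.
have t0 : 0 <= tensor (fun i z => `|fs i z|) y by apply: prodr_ge0.
apply: le_trans (ler_wpM2r t0 (CP v _ (normsq_ge0 (tuple_sub x y)))) _.
rewrite -[leLHS]mulrA ler_wpM2l ?mulr_ge0 ?wt_ge0 ?(ltW C0)//.
apply: le_trans (ler_wpM2r t0 (sum_le_prod _ (fun i => sqr_ge0 _))) _.
rewrite /tensor -big_split/=; apply: ler_prod => i _.
rewrite mulr_ge0 ?addr_ge0 ?sqr_ge0//= tnth_mktuple.
apply: (@le_trans _ _ ((1 + `|tnth x i|) ^+ 2 * (1 + `|tnth y i|) ^+ 2 * (K * wt 4 (tnth y i)))).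
  apply: ler_pM => //; first by rewrite addr_ge0 ?sqr_ge0.
  rewrite -exprMn; apply: (@le_trans _ _ ((1 + `|tnth x i - tnth y i|) ^+ 2)).
    by rewrite -(real_normK (num_real (_ - _))); have := normr_ge0 (tnth x i - tnth y i); nra.
  rewrite lerXn2r ?nnegrE ?mulr_ge0 ?(ltW (onenorm_gt0 _))//.
  by rewrite -[X in _ <= _ * (1 + X)]normrN onenormD.
by rewrite /F -mulrA [_ * (K * _)]mulrCA (wtD 2 2) (mulrA (_ ^+ 2) (wt 2 _)) wtVK mul1r.
Qed.

End tensor.

(** * Localisation of the Riesz potentials *)

Section riesz_tensor.
Variable R : realType.
Local Notation mu := (@lebesgue_measure R).
Local Notation leb n := (@lebesgue_tuple R n).

Definition heat_tensor n (a : R) (fs : 'I_n -> R -> R) (x : n.-tuple R) (v : R) : R :=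
  expR (a * v) * \prod_(i < n) gconv (expR (v / 2)) (fs i) (tnth x i).

(** The kernel exponent is H - n/2 = -2a, so subordination applies, and a factor of integral 0
    removes the b-term. [kappa] depends on n and H only and thus serves all tensors. *)
Lemma riesz_potential_tensor n (H : R) : (0 < n)%N -> 1 / 2 < H < 1 ->
  exists kappa : R, forall (fs : 'I_n -> R -> R) (K : R),
    (forall i, measurable_fun setT (fs i)) -> (forall i y, `|fs i y| <= K * wt 4 y) ->
    (exists i, \int[mu]_y fs i y = 0) ->
    forall x, let P := heat_tensor ((n%:R / 2 - H) / 2) fs x in
    mu.-integrable setT (EFin \o P) /\
    riesz_potential (H + n%:R / 2) (tensor fs) x = kappa * \int[mu]_v P v.
Proof.
move=> n0 /andP[H12 H1]; set a := (n%:R / 2 - H) / 2.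
(* For n = 1, a lies in (-1/4, 0) and the subtracted kernel is required; for n >= 2, a > 0. *)
pose b : R := (n == 1)%:R.
have ab : admissible a b.
  rewrite /admissible /b /a; case: eqVneq => [->|n1]; [right|left]; split => //.
    by apply/andP; split; lra.
  have : 2 <= n%:R :> R by rewrite ler_nat ltn_neqAle eq_sym n1.
  by move=> ?; lra.
have an : b = 0 -> a < n%:R / 2.
  move=> _; have : 1 <= n%:R :> R by rewrite ler1n.
  by rewrite /a => ?; lra.
have K0 := subord_const_neq0 ab.
set s := H + n%:R / 2.
pose kappa := (riesz_gamma n s)^-1 / subord_const a b.
exists kappa => fs K mfs fsK [i0 fi0] x P.
have [C CP] := subord_tensor_le x ab an mfs fsK.
have mt : measurable_fun setT (tensor fs) by exact: measurable_tuple_prod.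
have fsK2 i := decay_le (isT : (2 <= 4)%N) (fsK i).
have GP v : \int[leb n]_y (subord a b v (normsq (tuple_sub x y)) * tensor fs y) = P v.
  have [_ ->] := Rintegral_subord_tensor a b v x mfs fsK2.
  by rewrite /P /heat_tensor (bigD1 i0 (F := fun i => \int[mu]_y fs i y))//=
    fi0 mul0r mulr0 subr0.
have [iP _] := subordination n0 ab mt CP.
rewrite (funext GP) in iP; split => //.
(* The constant is put into the function: taking it out of the y-integral would ask for
   integrability of the Riesz kernel against the tensor. *)
have CP' v : (\int[leb n]_y `|(subord a b v (normsq (tuple_sub x y)) * (kappa * tensor fs y))%:E|
    <= (`|kappa| * C * wt 2 v)%:E)%E.
  under eq_integral => y _.
    rewrite mulrCA EFinM abseM.
    over.
  have [i1 _] := Rintegral_subord_tensor a b v x mfs fsK2.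
  rewrite ge0_integralZl//; last first.
    by apply: measurableT_comp => //; case/integrableP: i1.
  by rewrite -mulrA [leRHS]EFinM; apply: lee_wpmul2l; [exact: abse_ge0|exact: CP].
have [_ E] := subordination n0 ab (measurable_funM (measurable_cst kappa) mt) CP'.
transitivity (\int[leb n]_y (subord_const a b *
    (norm2 (tuple_sub x y) `^ (- (2 * a)) * (kappa * tensor fs y)))).
  apply: eq_Rintegral => y _; rewrite /riesz_kernel.
  have -> : s - n%:R = - (2 * a) by rewrite /s /a; field.
  rewrite /kappa; set r := _ `^ _; set g := riesz_gamma _ _; set t := tensor _ _.
  have -> : subord_const a b * (r * (g^-1 / subord_const a b * t)) =
    (subord_const a b / subord_const a b) * (g^-1 * r * t) by ring.
  by rewrite divff// mul1r.
rewrite E -RintegralZl//; apply: eq_Rintegral => v _.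
rewrite -GP -RintegralZl//; last first.
  by have [] := Rintegral_subord_tensor a b v x mfs fsK2.
by apply: eq_Rintegral => y _; rewrite mulrCA.
Qed.

(** One envelope for the three regimes; [vm] records whether the gain l^M from vanishing moments is
    available. *)
Lemma gconv_le p M : exists2 C : R, 0 <= C & forall K l x (f : R -> R) (vm : bool), 0 < l ->
  measurable_fun setT f -> (forall y, `|f y| <= K * wt (M + p + 2) y) ->
  (vm -> vanishing_moments f) ->
  `|gconv l f x| <=
    C * K * (if 1 <= l then l^-1 else (if vm then l ^+ M else 1) * l ^- p) * wt p x.
Proof.
have [C1 C10 CP1] := gconv_le_large R p.
have [C2 C20 CP2] := gconv_le_small R p.
have [C3 C30 CP3] := @gconv_le_moment R p M.
exists (C1 + C2 + C3); first by rewrite !addr_ge0.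
move=> K l x f vm l0 mf fK fv; have K0 := decay_ge0 fK.
have up (c : R) (c' : R) B : 0 <= B -> c <= c' -> c * K * B * wt p x <= c' * K * B * wt p x.
  by move=> B0 cc; rewrite !ler_wpM2r ?wt_ge0.
case: ifPn => [l1|]; last rewrite -ltNge => /ltW l1.
  apply: le_trans (up C1 _ _ _ _); [|by rewrite invr_ge0 ltW|by rewrite -addrA lerDl addr_ge0].
  by apply: CP1 => //; apply: decay_le fK; rewrite addnAC leq_addl.
case: vm fv => [/(_ isT) fv|_].
  apply: le_trans (up C3 _ _ _ _).
  - by rewrite mulrA; exact: CP3.
  - by rewrite mulr_ge0 ?invr_ge0 ?exprn_ge0 ?(ltW l0).
  - by rewrite lerDr addr_ge0.
apply: le_trans (up C2 _ _ _ _).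
- by rewrite mul1r; apply: CP2 => //; apply: decay_le fK; rewrite -addnA leq_addl.
- by rewrite mul1r invr_ge0 exprn_ge0 ?(ltW l0).
- by rewrite addrAC lerDr addr_ge0.
Qed.

(** What the estimates use of Schwartz functions. The increment bound is linear in s with the same
    weights, so f(.+s) - f is treated like f with K replaced by sK. *)
Definition rapid (f : R -> R) := measurable_fun setT f /\
  forall N, exists2 K, 0 <= K & forall y, `|f y| <= K * wt N y /\
    forall s, 0 <= s <= 1 -> `|f (y + s) - f y| <= s * K * wt N y.

Lemma vanishing_momentsB (f : R -> R) s : rapid f -> vanishing_moments f ->
  0 <= s <= 1 -> vanishing_moments (fun y => f (y + s) - f y).
Proof.
move=> [mf fr] f0 s01 Q; have [K K0 fK] := fr (size Q + 2)%N.
have fs0 := vanishing_moments_shift s mf f0.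
have ms : measurable_fun setT (fun y : R => f (y + s)) by exact: measurable_shift.
have i1 : mu.-integrable setT (EFin \o (fun y => Q.[y] * f y)).
  by apply: (@poly_mul_integrable R Q f K (size Q + 2)) => // y; have [] := fK y.
have i2 : mu.-integrable setT (EFin \o (fun y => Q.[y] * f (y + s))).
  apply: (@poly_mul_integrable R Q (fun y => f (y + s)) (2 * K) (size Q + 2)) => // y.
  have [h1 /(_ s s01) h2] := fK y.
  rewrite -[f _](subrK (f y)) (le_trans (ler_normD _ _))//.
  apply: le_trans (lerD h2 h1) _; rewrite -mulrDl ler_wpM2r ?wt_ge0//.
  by case/andP: s01 => s0 s1; nra.
under eq_Rintegral => y _ do rewrite mulrBr.
by rewrite RintegralB// f0 fs0 subrr.
Qed.

(** For l = e^{v/2} < 1 the factor [i0] contributes l^(np+1), which cancels the n losses l^-p and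
    leaves one l. The result is e^{(a+1/2)v} at -oo and e^{(a-n/2)v} at +oo, whence the two
    conditions on a. *)
Lemma heat_envelope n (a : R) p : - (1 / 2) < a -> a < n%:R / 2 -> (0 < n)%N ->
  exists2 C, 0 < C & forall (i0 : 'I_n) v,
  expR (a * v) * \prod_(i < n) (if 1 <= expR (v / 2) then (expR (v / 2))^-1 else
    (if i == i0 then expR (v / 2) ^+ (n * p + 1) else 1) * expR (v / 2) ^- p) <= C * wt 2 v.
Proof.
move=> a1 a2 n0.
pose h v := expR (a * v) * (if 0 <= v then expR (- (v / 2)) ^+ n else expR (v / 2)).
have h0 v : 0 <= h v by rewrite mulr_ge0 ?expR_ge0//; case: ifP; rewrite ?exprn_ge0 ?expR_ge0.
have [||||C C0 CP] := @expRN_decay2 R (n%:R / 2 - a) (a + 1 / 2) h.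
- by rewrite subr_gt0.
- by lra.
- exists 1 => // v v0; rewrite ger0_norm// /h v0 -expRM_natl -expRD mul1r ler_expR.
  by rewrite le_eqVlt; apply/orP; left; apply/eqP; ring.
- exists 1 => // v v0; rewrite ger0_norm// /h mul1r; case: ifPn => v0'.
    have -> : v = 0 by apply/eqP; rewrite eq_le v0 v0'.
    by rewrite !mulr0 mul0r oppr0 expR0 expr1n mulr1.
  by rewrite -expRD ler_expR le_eqVlt; apply/orP; left; apply/eqP; ring.
exists C => // i0 v; apply: le_trans (le_trans (ler_norm _) (CP v)).
rewrite /h ler_wpM2l ?expR_ge0//.
have -> : (1 <= expR (v / 2)) = (0 <= v).
  by rewrite -[X in X <= _]expR0 ler_expR pmulr_lge0.
case: ifPn => v0; first by rewrite prodr_const card_ord -expRN.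
rewrite big_split/= prodr_const card_ord -big_mkcond/= big_pred1_eq.
rewrite -exprVn -exprM mulnC exprD expr1 exprVn mulrAC divff ?mul1r//.
by rewrite expf_neq0// gt_eqF// expR_gt0.
Qed.

Definition shift_tuple n (x : n.-tuple R) (s : R) : n.-tuple R := [tuple tnth x i + s | i < n].

(** For each v the integrand of Theta is a product of Gaussian convolutions, bounded by the envelope
    in v times the weights in x; integrating in v leaves the weights. Increments are telescoped over
    the coordinates. *)
Lemma riesz_tensor_bounds n (H : R) (phi psi : R -> R) p :
  (0 < n)%N -> 1 / 2 < H < 1 -> rapid phi -> rapid psi -> vanishing_moments psi ->
  exists2 K : R, 0 <= K & forall (eps : n.-tuple bool), nonzero_type eps ->
    let Theta := riesz_potential (H + n%:R / 2) (tensor_wavelet phi psi eps) in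
    forall x, `|Theta x| <= K * \prod_(i < n) wt p (tnth x i) /\
      forall s, 0 <= s <= 1 ->
        `|Theta (shift_tuple x s) - Theta x| <= s * K * \prod_(i < n) wt p (tnth x i).
Proof.
move=> n0 H01 rphi rpsi vpsi; have [kappa kP] := riesz_potential_tensor n0 H01.
case/andP: (H01) => H12 H1.
set a := (n%:R / 2 - H) / 2 in kP.
(* [M] moments are spent on one coordinate; the decay order [N] covers both M+p+2, for the
   convolutions, and 4, for the subordination. *)
pose M := (n * p + 1)%N; pose N := (M + p + 2 + 4)%N.
have n1 : 1 <= n%:R :> R by rewrite ler1n.
have [D D0 DP] : exists2 C, 0 < C & forall (i0 : 'I_n) v,
  expR (a * v) * \prod_(i < n) (if 1 <= expR (v / 2) then (expR (v / 2))^-1 else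
    (if i == i0 then expR (v / 2) ^+ (n * p + 1) else 1) * expR (v / 2) ^- p) <= C * wt 2 v.
  by apply: heat_envelope => //; rewrite /a; lra.
have [C C0 CP] := gconv_le p M.
have [K1 K10 fK1] := rphi.2 N; have [K2 K20 fK2] := rpsi.2 N.
pose K := K1 + K2; have K0 : 0 <= K by rewrite addr_ge0.
have [L LE] : exists L, L = D * \int[mu]_v wt 2 v by exists (D * \int[mu]_v wt 2 v).
have W0 : 0 <= \int[mu]_v @wt R 2 v by apply: Rintegral_ge0 => v _; exact: wt_ge0.
have L0 : 0 <= L by rewrite LE mulr_ge0 ?(ltW D0).
exists (`|kappa| * (n%:R * (2 * (C * K)) ^+ n * L)) => [|eps /existsP[i0 epsi0] Theta x].
  by do ! (apply: mulr_ge0 || apply: exprn_ge0) => //.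
pose fs i := if tnth eps i then psi else phi.
have rfs i : rapid (fs i) by rewrite /fs; case: ifP.
have mfs i : measurable_fun setT (fs i) by case: (rfs i).
have fsK i y : `|fs i y| <= K * wt N y /\
    forall s, 0 <= s <= 1 -> `|fs i (y + s) - fs i y| <= s * K * wt N y.
  have up c s : 0 <= s -> c <= K -> s * c * wt N y <= s * K * wt N y.
    by move=> s0 cK; rewrite ler_wpM2r ?wt_ge0// ler_wpM2l.
  rewrite /fs; case: ifP => _.
    have [h1 h2] := fK2 y; have k : K2 <= K by rewrite lerDr.
    split; first by rewrite (le_trans h1)// ler_wpM2r ?wt_ge0.
    by move=> s s01; apply: le_trans (h2 s s01) (up _ _ _ k); case/andP: s01.
  have [h1 h2] := fK1 y; have k : K1 <= K by rewrite lerDl.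
  split; first by rewrite (le_trans h1)// ler_wpM2r ?wt_ge0.
  by move=> s s01; apply: le_trans (h2 s s01) (up _ _ _ k); case/andP: s01.
have fsK4 i : forall y, `|fs i y| <= K * wt 4 y.
  by apply: (@decay_le R K (fs i) 4 N) => [|y]; [rewrite leq_addl|case: (fsK i y)].
have fsKM i : forall y, `|fs i y| <= K * wt (M + p + 2) y.
  by apply: (@decay_le R K (fs i) _ N) => [|y]; [rewrite leq_addr|case: (fsK i y)].
have vfs : vanishing_moments (fs i0) by rewrite /fs epsi0.
have fi0 : exists i, \int[mu]_y fs i y = 0.
  by exists i0; have := vfs 1; under eq_Rintegral do rewrite hornerC mul1r.
have TE y : mu.-integrable setT (EFin \o heat_tensor a fs y) /\
    Theta y = kappa * \int[mu]_v heat_tensor a fs y v.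
  exact: (kP fs K mfs fsK4 fi0 y).
pose U v i := C * K * (if 1 <= expR (v / 2) then (expR (v / 2))^-1 else
    (if i == i0 then expR (v / 2) ^+ M else 1) * expR (v / 2) ^- p) * wt p (tnth x i).
pose W := \prod_(i < n) wt p (tnth x i).
have WE0 : 0 <= W by apply: prodr_ge0 => i _; exact: wt_ge0.
have UE v : expR (a * v) * \prod_(i < n) U v i <= (C * K) ^+ n * W * (D * wt 2 v).
  rewrite /U 2!big_split/= prodr_const card_ord.
  set B := \prod_(i < n) (if _ then _ else _).
  have -> : expR (a * v) * ((C * K) ^+ n * B * W) = (C * K) ^+ n * W * (expR (a * v) * B) by ring.
  by rewrite ler_wpM2l ?DP// mulr_ge0// exprn_ge0// mulr_ge0.
have gU v i : `|gconv (expR (v / 2)) (fs i) (tnth x i)| <= U v i.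
  by apply: CP => //; [exact: expR_gt0|move=> /eqP ->].
have ge1 : 1 <= n%:R * 2 ^+ n :> R.
  by rewrite -[leLHS]mulr1 ler_pM// exprn_ege1// ler1n.
have intW c : mu.-integrable setT (EFin \o (fun v => c * (D * wt 2 v))).
  by apply: integrableZl (integrable_wt2Z D).
have EW c : \int[mu]_v (c * (D * wt 2 v)) = c * L.
  rewrite RintegralZl//; last exact: integrable_wt2Z.
  by rewrite RintegralZl ?LE//; exact: integrable_wt2.
have mint y : measurable_fun setT (heat_tensor a fs y).
  by case: (TE y) => /integrableP[/measurable_EFinP].
split.
  rewrite (TE x).2 normrM -!mulrA ler_wpM2l//.
  apply: (@le_trans _ _ ((C * K) ^+ n * W * L)); last first.
    rewrite (exprMn n 2 (C * K)) -/W.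
    have -> : n%:R * (2 ^+ n * (C * K) ^+ n * (L * W)) =
        n%:R * 2 ^+ n * ((C * K) ^+ n * W * L) by ring.
    by rewrite ler_peMl// !mulr_ge0 ?exprn_ge0 ?mulr_ge0.
  rewrite -EW; apply: dominated_Rintegral; [exact: mint|exact: intW|move=> v].
  rewrite /heat_tensor normrM ger0_norm ?expR_ge0// normr_prod.
  apply: le_trans (UE v); rewrite ler_wpM2l ?expR_ge0//.
  by apply: ler_prod => i _; rewrite normr_ge0 gU.
move=> s s01; case/andP: (s01) => s0 s1.
rewrite (TE x).2 (TE (shift_tuple x s)).2 -mulrBr normrM.
rewrite -RintegralB//; [|exact: (TE _).1|exact: (TE _).1].
have -> : s * (`|kappa| * (n%:R * (2 * (C * K)) ^+ n * L)) * \prod_(i < n) wt p (tnth x i) =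
    `|kappa| * ((n%:R * s * 2 ^+ n) * ((C * K) ^+ n * W) * L).
  by rewrite (exprMn n 2 (C * K)) /W; ring.
rewrite ler_wpM2l// -EW; apply: dominated_Rintegral.
- by apply: measurable_funB; exact: mint.
- exact: intW.
move=> v; rewrite /heat_tensor -mulrBr normrM ger0_norm ?expR_ge0//.
rewrite -mulrA.
apply: (@le_trans _ _ (n%:R * s * 2 ^+ n * (expR (a * v) * \prod_(i < n) U v i))); last first.
  by rewrite ler_wpM2l ?UE// !mulr_ge0.
rewrite [leRHS]mulrCA ler_wpM2l ?expR_ge0//.
(* The doubled [U] also bounds the convolution at the shifted point, because s <= 1. *)
have -> : n%:R * s * 2 ^+ n * \prod_(i < n) U v i = n%:R * s * \prod_(i < n) (2 * U v i).
  by rewrite [in RHS]big_split/= prodr_const card_ord; ring.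
have U0 i : 0 <= U v i by rewrite (le_trans _ (gU v i)).
(* The difference is the convolution of f(.+s) - f, whose decay constant is sK and which, in
   coordinate [i0], still has vanishing moments. *)
have dU i : `|gconv (expR (v / 2)) (fs i) (tnth (shift_tuple x s) i) -
     gconv (expR (v / 2)) (fs i) (tnth x i)| <= s * U v i.
  rewrite tnth_mktuple gconv_shift// -(@gconvB R _ _ _ _ (2 * K) K)//.
  - have -> : s * U v i = C * (s * K) * (if 1 <= expR (v / 2) then (expR (v / 2))^-1 else
        (if i == i0 then expR (v / 2) ^+ M else 1) * expR (v / 2) ^- p) * wt p (tnth x i).
      by rewrite /U !mulrA (mulrC s).
    apply: CP => //.
    + exact: expR_gt0.
    + by apply: measurable_funB => //; exact: measurable_shift.
    + move=> y; have [_ /(_ s s01) h] := fsK i y; apply: le_trans h _.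
      by rewrite ler_wpM2l ?mulr_ge0// wt_le// leq_addr.
    + by move=> /eqP ->; exact: vanishing_momentsB.
  - exact: measurable_shift.
  - move=> y; have [h1 /(_ s s01) h2] := fsK i y.
    rewrite -[fs i _](subrK (fs i y)) (le_trans (ler_normD _ _))//.
    apply: le_trans (lerD h2 h1) _; rewrite -mulrDl.
    apply: ler_pM; rewrite ?wt_ge0 ?addr_ge0 ?mulr_ge0//; last first.
      by rewrite wt_le// (leq_trans _ (leq_addl _ 4)).
    by nra.
  - exact: (decay_le (isT : (2 <= 4)%N) (fsK4 i)).
apply: prod_diff_le => i.
- rewrite -[gconv _ _ _](subrK (gconv (expR (v / 2)) (fs i) (tnth x i))).
  rewrite (le_trans (ler_normD _ _))// mulr_natl mulr2n lerD//.
  by rewrite (le_trans (dU i))// ler_piMl.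
- by rewrite (le_trans (gU v i))// mulr_natl mulr2n lerDl.
- by rewrite (le_trans (dU i))// ler_wpM2l// mulr_natl mulr2n lerDl.
Qed.

End riesz_tensor.

(** * Schwartz functions *)

Section schwartz.
Variable R : realType.
Local Notation mu := (@lebesgue_measure R).
Implicit Types f : R -> R.

Lemma onenorm_exp_le (t : R) N : 0 <= t -> (1 + t) ^+ N <= 2 ^+ N * (1 + t ^+ N).
Proof.
move=> t0; have [t1|/ltW t1] := leP t 1.
  apply: (@le_trans _ _ (2 ^+ N)); last by rewrite ler_peMr ?exprn_ge0// lerDl exprn_ge0.
  by rewrite lerXn2r ?nnegrE ?addr_ge0// -natr1 lerD2l.
apply: (@le_trans _ _ (2 ^+ N * t ^+ N)); last first.
  by rewrite ler_wpM2l ?exprn_ge0// lerDr.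
by rewrite -exprMn lerXn2r ?nnegrE ?addr_ge0 ?mulr_ge0// mulr_natl mulr2n lerD2r.
Qed.

Lemma schwartz_decay f k : schwartz f -> forall N, exists2 K, 0 <= K &
  forall y, `|derive1n k f y| <= K * wt N y.
Proof.
move=> [_ fs] N; have [C0 CP0] := fs 0%N k; have [C1 CP1] := fs N k.
have C00 : 0 <= C0 by rewrite (le_trans _ (CP0 0)).
have C10 : 0 <= C1 by rewrite (le_trans _ (CP1 0)).
exists (2 ^+ N * (C0 + C1)) => [|y]; first by rewrite mulr_ge0 ?exprn_ge0 ?addr_ge0.
rewrite -[leLHS]mulr1 -[X in _ * X <= _](wtVK N y) mulrA ler_wpM2r ?wt_ge0// mulrC.
apply: le_trans (ler_wpM2r (normr_ge0 _) (onenorm_exp_le N (normr_ge0 y))) _.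
rewrite -[leLHS]mulrA ler_wpM2l ?exprn_ge0// mulrDl mul1r.
rewrite -normrX -normrM lerD ?CP1//.
by have := CP0 y; rewrite expr0 mul1r.
Qed.

Lemma schwartz_is_derive f (x : R) : schwartz f -> is_derive x 1 f (derive1n 1 f x).
Proof. by move=> [/(_ 0%N x) df _]; apply: DeriveDef => //; rewrite /= derive1E. Qed.

(** The mean value theorem bounds the increment; the intermediate point is within 1 of y, so
    Peetre's inequality costs 2^N. *)
Lemma schwartz_rapid f : schwartz f -> rapid f.
Proof.
move=> sf; have df x := schwartz_is_derive x sf.
split.
  apply: continuous_measurable_fun => x.
  by apply/differentiable_continuous/derivable1_diffP; case: (df x).
move=> N; have [K0 K00 KP0] := schwartz_decay 0 sf N.
have [K1 K10 KP1] := schwartz_decay 1 sf N.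
exists (K0 + 2 ^+ N * K1) => [|y]; first by rewrite addr_ge0// mulr_ge0 ?exprn_ge0.
split; first by rewrite (le_trans (KP0 y))// ler_wpM2r ?wt_ge0// lerDl mulr_ge0 ?exprn_ge0.
move=> s /andP[s0 s1].
have [c [+ ->]] := mean_value y (y + s) df.
rewrite addrAC subrr add0r => cy.
rewrite normrM (ger0_norm s0) mulrC -mulrA ler_wpM2l//.
apply: le_trans (KP1 c) _.
have -> : c = y - (y - c) by rewrite opprB addrC subrK.
apply: le_trans (ler_wpM2l K10 (wt_shift N y (y - c))) _.
rewrite mulrA ler_wpM2r ?wt_ge0// mulrC (@le_trans _ _ (2 ^+ N * K1)) ?lerDr//.
rewrite ler_wpM2r// lerXn2r ?nnegrE ?(ltW (onenorm_gt0 _))//.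
by rewrite -natr1 addrC lerD2r distrC (le_trans cy)// ger0_norm.
Qed.

Lemma schwartz_vanishing_moments f : schwartz f ->
  (forall n : nat, \int[mu]_x (x ^+ n * f x) = 0) -> vanishing_moments f.
Proof.
move=> sf f0; have [mf rf] := schwartz_rapid sf.
have iQ (Q : {poly R}) : mu.-integrable setT (EFin \o (fun y => Q.[y] * f y)).
  have [K K0 fK] := rf (size Q + 2)%N.
  by apply: (@poly_mul_integrable R Q f K (size Q + 2)) => // y; case: (fK y).
move=> Q; rewrite -(coefK Q) poly_def.
apply: (big_ind (fun Q : {poly R} => \int[mu]_y (Q.[y] * f y) = 0)).
- by under eq_Rintegral do rewrite horner0 mul0r; rewrite Rintegral_cst// mul0r.
- move=> p q p0 q0; under eq_Rintegral do rewrite hornerD mulrDl.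
  by rewrite RintegralD// p0 q0 addr0.
- move=> i _; under eq_Rintegral do rewrite hornerZ hornerXn -mulrA.
  rewrite RintegralZl//; first by rewrite f0 mulr0.
  by have := iQ 'X^i; congr (_.-integrable _ (_ \o _)); apply/funext => y; rewrite hornerXn.
Qed.

End schwartz.

(** * Summation over the wavelet indices *)

Section finite_subsums.
Variable R : realType.

(** For nonnegative terms, a bound on all finite duplicate-free sums is a bound on the infinite sum,
    free of convergence and order of summation. *)
Definition sum_le (T : eqType) (f : T -> R) (M : R) :=
  forall s : seq T, uniq s -> \sum_(x <- s) f x <= M.

Lemma sum_le_inj (T U : eqType) (h : T -> U) (f : U -> R) M :
  injective h -> sum_le f M -> sum_le (f \o h) M.
Proof. by move=> hI fM s us; rewrite -(big_map h xpredT f) fM// map_inj_uniq. Qed.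

Lemma sum_leD (T : eqType) (f g : T -> R) M N :
  sum_le f M -> sum_le g N -> sum_le (fun x => f x + g x) (M + N).
Proof. by move=> fM gN s us; rewrite big_split/= lerD ?fM ?gN. Qed.

Lemma sum_leZ (T : eqType) (f : T -> R) M c :
  0 <= c -> sum_le f M -> sum_le (fun x => c * f x) (c * M).
Proof. by move=> c0 fM s us; rewrite -mulr_sumr ler_wpM2l ?fM. Qed.

Lemma sum_le_ge0 (T : eqType) (f : T -> R) M : sum_le f M -> 0 <= M.
Proof. by move=> /(_ [::] isT); rewrite big_nil. Qed.

Lemma le_sum_le (T : eqType) (f g : T -> R) M :
  (forall x, f x <= g x) -> sum_le g M -> sum_le f M.
Proof. by move=> fg gM s us; rewrite (le_trans _ (gM s us))// ler_sum. Qed.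

Lemma sum_le_fin (T : finType) : sum_le (fun _ : T => 1) #|T|%:R.
Proof.
move=> s us; rewrite big_const_seq iter_addr addr0 count_predT -mulr_natr mul1r ler_nat.
by rewrite -(card_uniqP us) max_card.
Qed.

(** The list of pairs is grouped by first component; the second components in each group are again
    duplicate-free. *)
Lemma sum_le_pair (T U : eqType) (f : T -> R) (g : T -> U -> R) M N :
  (forall x, 0 <= f x) -> sum_le f M -> 0 <= N -> (forall x, sum_le (g x) N) ->
  sum_le (fun z : T * U => f z.1 * g z.1 z.2) (M * N).
Proof.
move=> f0 fM N0 gN s us; pose X := undup (map fst s).
have -> : \sum_(z <- s) f z.1 * g z.1 z.2 =
    \sum_(x <- X) f x * \sum_(y <- [seq z.2 | z <- s & z.1 == x]) g x y.
  under [RHS]eq_bigr => x _ do rewrite big_map big_filter mulr_sumr.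
  rewrite (exchange_big_dep xpredT)//= big_seq_cond [RHS]big_seq_cond; apply: eq_bigr => z.
  rewrite andbT => zs; rewrite (eq_bigl (pred1 z.1)) => [|x]; last by rewrite /= eq_sym.
  by rewrite -big_filter filter_pred1_uniq ?undup_uniq ?mem_undup ?map_f// big_seq1.
apply: (@le_trans _ _ (\sum_(x <- X) f x * N)); last first.
  by rewrite -mulr_suml ler_wpM2r// fM// undup_uniq.
apply: ler_sum => x _; rewrite ler_wpM2l// gN//.
rewrite map_inj_in_uniq ?filter_uniq// => -[a b] [a' b'].
by rewrite !mem_filter/= => /andP[/eqP -> _] /andP[/eqP -> _] ->.
Qed.

Lemma sum_le_tuple (T : eqType) n (f : T -> R) M : (forall x, 0 <= f x) ->
  sum_le f M -> sum_le (fun k : n.-tuple T => \prod_(i < n) f (tnth k i)) (M ^+ n).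
Proof.
move=> f0 fM; elim: n => [|n IH].
  move=> [|k [|k' s]] us; rewrite ?big_nil ?ler01// ?big_cons ?big_nil.
    by rewrite big_ord0 addr0.
  by move: us; rewrite /= inE (tuple0 k) (tuple0 k') eqxx.
pose h (k : n.+1.-tuple T) := (thead k, [tuple of behead k]).
have hI : injective h.
  move=> k k' [e1 e2]; rewrite (tuple_eta k) (tuple_eta k') e1; apply/val_inj => /=.
  by rewrite e2.
have := sum_le_inj hI (sum_le_pair f0 fM (sum_le_ge0 IH) (fun _ => IH)).
rewrite exprS; apply: le_sum_le => k /=.
case/tupleP: k => x t; rewrite theadE big_ord_recl tnth0.
rewrite ler_wpM2l// ler_prod// => i _; rewrite f0/=.
by rewrite tnthS le_eqVlt; apply/orP; left; apply/eqP; congr (f (tnth _ i)); exact/val_inj.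
Qed.

(** Telescoping: (1+n)^-2 <= 2 (1/(n+1) - 1/(n+2)). *)
Lemma sum_le_nat : sum_le (fun n : nat => (1 + n%:R) ^- 2) 2.
Proof.
move=> s us; pose N := (\max_(i <- s) i).+1.
have -> : \sum_(x <- s) (1 + x%:R) ^- 2 =
    \sum_(x <- [seq i <- index_iota 0 N | i \in s]) (1 + x%:R) ^- 2 :> R.
  apply: perm_big; apply: uniq_perm => //; first by rewrite filter_uniq// iota_uniq.
  move=> x; rewrite mem_filter mem_index_iota/=; case: (boolP (x \in s)) => //= xs.
  by rewrite ltnS (big_rem x xs)/= leq_maxl.
rewrite big_filter big_mkcond/=.
apply: (@le_trans _ _ (\sum_(0 <= i < N) (2 * (i.+1%:R^-1 - i.+2%:R^-1)))).
  apply: ler_sum => i _; have i0 : 0 <= i%:R :> R by [].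
  have -> : 2 * (i.+1%:R^-1 - i.+2%:R^-1) = 2 / (i.+1%:R * i.+2%:R) :> R.
    by rewrite -(natr1 i.+1) -(natr1 i); field; apply/andP; split; rewrite gt_eqF//; lra.
  case: ifP => _; last by rewrite divr_ge0// mulr_ge0.
  rewrite ler_pdivlMr ?mulr_gt0// mulrC ler_pdivrMr ?exprn_gt0 ?ltr_pwDl//.
  by rewrite -(natr1 i.+1) -(natr1 i); nra.
rewrite -mulr_sumr -[leRHS]mulr1 ler_wpM2l//.
have -> n : \sum_(0 <= i < n) (i.+1%:R^-1 - i.+2%:R^-1) = 1 - n.+1%:R^-1 :> R.
  elim: n => [|n IH]; first by rewrite big_geq// invr1 subrr.
  by rewrite big_nat_recr//= IH addrA subrK.
by rewrite gerBl.
Qed.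

Lemma sum_le_int : sum_le (fun l : int => @wt R 2 l%:~R) 4.
Proof.
move=> s us; rewrite (bigID (fun l : int => 0 <= l))/= (_ : 4 = 2 + 2)//; last by ring.
have half (P : pred int) : {in P &, injective absz} ->
    \sum_(l <- s | P l) @wt R 2 l%:~R <= 2.
  move=> Pi; rewrite -big_filter.
  have -> : \sum_(l <- [seq l <- s | P l]) @wt R 2 l%:~R =
      \sum_(n <- map absz [seq l <- s | P l]) (1 + n%:R) ^- 2.
    by rewrite big_map; apply: eq_bigr => l _; rewrite /wt -intr_norm -abszE.
  apply: sum_le_nat; rewrite map_inj_in_uniq ?filter_uniq// => x y.
  by rewrite !mem_filter => /andP[Px _] /andP[Py _]; exact: Pi.
by apply: lerD; apply: half => -[x|x] [y|y] //= _ _ [->].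
Qed.

(** Replacing x by its floor increases 1+|x-k| by a factor at most 2, which costs 4 in the weight;
    the sum over the integers gives the other 4. *)
Lemma sum_le_shift (x : R) : sum_le (fun k : int => wt 2 (x - k%:~R)) 16.
Proof.
have inj : injective (fun k : int => k - Num.floor x) by move=> k k' /addIr.
have -> : 16 = 4 * 4 :> R by ring.
have := sum_leZ (ler0n R 4) (sum_le_inj inj sum_le_int).
apply: le_sum_le => k /=.
rewrite /wt -ler_pdivrMl// -invfM lef_pV2 ?posrE ?mulr_gt0 ?exprn_gt0 ?onenorm_gt0//.
have -> : 4 = 2 ^+ 2 :> R by ring.
rewrite -exprMn lerXn2r ?nnegrE ?mulr_ge0 ?(ltW (onenorm_gt0 _))//.
have := Num.Theory.real_floorD1_gt (num_real x).
have := Num.Theory.ge_floor x.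
rewrite intrB; set fl := (Num.floor x)%:~R; set kk := k%:~R.
rewrite intrD -/fl => f1 f2.
have : `|kk - fl| <= `|x - kk| + 1; last by have := normr_ge0 (x - kk); lra.
have -> : kk - fl = - (x - kk) + (x - fl) by ring.
rewrite (le_trans (ler_normD _ _))// normrN lerD2l ger0_norm; lra.
Qed.

End finite_subsums.

(** * Logarithmic weights and the bound at each scale *)

Section log_weights.
Variable R : realType.
Local Notation e := (expR 1 : R).

Lemma ln_le_subr1 (x : R) : 0 < x -> ln x <= x - 1.
Proof. by move=> x0; have := expR_ge1Dx (ln x); rewrite lnK ?posrE//; lra. Qed.

Lemma ln_ge1 (x : R) : e <= x -> 1 <= ln x.
Proof.
by move=> ex; rewrite -[leLHS]expRK ler_ln ?posrE ?expR_gt0// (lt_le_trans (expR_gt0 _) ex).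
Qed.

(** As ln x >= 1, the sum of logarithms is at most a product, in which the two variables
    separate. *)
Lemma ln_mul_le (x P : R) : e <= x -> 1 <= P -> ln (x * P) <= ln x * (1 + ln P).
Proof.
move=> ex P1; have x0 : 0 < x by rewrite (lt_le_trans _ ex)// expR_gt0.
rewrite lnM ?posrE ?(lt_le_trans _ P1)// mulrDr mulr1 lerD2l ler_peMl ?ln_ge0//.
exact: ln_ge1.
Qed.

Lemma powR_half_mul_le (n : nat) (x P : R) : 0 <= x -> 1 <= P ->
  (x * P) `^ (n%:R / 2) <= x `^ (n%:R / 2) * P ^+ n.
Proof.
move=> x0 P1; rewrite powRM// ?(le_trans ler01)// ler_wpM2l ?powR_ge0//.
rewrite -powR_mulrn ?(le_trans ler01)// ler_powR//.
by rewrite ler_pdivrMr// mulr_natr mulr2n lerDl.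
Qed.

Lemma le_powR_half (n : nat) (x y : R) : 0 <= x -> x <= y ->
  x `^ (n%:R / 2) <= y `^ (n%:R / 2).
Proof.
by move=> x0 xy; rewrite ge0_ler_powR ?nnegrE ?divr_ge0// (le_trans x0).
Qed.

(** Since |k_i| <= |y_i| + X, the argument of the logarithm is at most E P with P the product of the
    1+|y_i|. The logarithm splits off a power of P, paid by n of the n+2 powers of decay; the other
    two serve the sum over k. *)
Lemma weight_le n (w X : R) (k : n.-tuple int) (y : n.-tuple R) : 0 <= w -> 0 <= X ->
  (forall i, `|tnth k i|%:~R <= `|tnth y i| + X) ->
  ln (e + w + (\sum_(i < n) `|tnth k i|)%:~R) `^ (n%:R / 2) *
    \prod_(i < n) wt (n + 2) (tnth y i) <=
  ln (e + w + n%:R * X) `^ (n%:R / 2) * \prod_(i < n) wt 2 (tnth y i).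
Proof.
move=> w0 X0 kyX; set E := e + w + n%:R * X.
pose P := \prod_(i < n) (1 + `|tnth y i|).
have P1 : 1 <= P.
  by rewrite /P; elim/big_rec: _ => // i x _ x1; rewrite mulr_ege1// onenorm_ge1.
have eE : e <= E by rewrite /E -addrA lerDl addr_ge0// mulr_ge0.
have E0 : 0 < E by rewrite (lt_le_trans _ eE)// expR_gt0.
have k0 : 0 <= (\sum_(i < n) `|tnth k i|)%:~R :> R.
  by rewrite ler0z sumr_ge0.
have le1 : e + w + (\sum_(i < n) `|tnth k i|)%:~R <= E * P.
  apply: (@le_trans _ _ (E * (1 + \sum_(i < n) `|tnth y i|))); last first.
    by rewrite ler_wpM2l ?(ltW E0)// sum_le_prod.
  apply: (@le_trans _ _ (E + \sum_(i < n) `|tnth y i|)); last first.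
    rewrite mulrDr mulr1 lerD2l ler_peMl ?sumr_ge0//.
    by rewrite (le_trans _ eE)// -[leLHS]expR0 ler_expR.
  suff : (\sum_(i < n) `|tnth k i|)%:~R <= \sum_(i < n) `|tnth y i| + n%:R * X by rewrite /E; lra.
  rewrite rmorph_sum/= (_ : n%:R * X = \sum_(i < n) X); last first.
    by rewrite sumr_const card_ord mulr_natl.
  by rewrite -big_split/=; apply: ler_sum => i _; exact: kyX.
have wE : \prod_(i < n) @wt R 2 (tnth y i) = P ^+ n * \prod_(i < n) wt (n + 2) (tnth y i).
  rewrite /P -prodrXl -big_split/=; apply: eq_bigr => i _.
  by rewrite wtD mulrA wtVK mul1r.
have W0 : 0 <= \prod_(i < n) @wt R (n + 2) (tnth y i).
  by apply: prodr_ge0 => i _; exact: wt_ge0.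
rewrite wE mulrA ler_wpM2r//.
have l1 : 1 <= ln E by exact: ln_ge1.
apply: (@le_trans _ _ ((ln E * P) `^ (n%:R / 2))).
  apply: le_powR_half.
    by rewrite ln_ge0// -addrA (@le_trans _ _ e) ?lerDl ?addr_ge0// -[leLHS]expR0 ler_expR.
  apply: (@le_trans _ _ (ln (E * P))).
    by rewrite ler_ln ?posrE ?mulr_gt0 ?(lt_le_trans _ P1)// -addrA ltr_wpDr ?expR_gt0// addr_ge0.
  apply: le_trans (ln_mul_le eE P1) _; rewrite ler_wpM2l ?(le_trans ler01)//.
  by have := ln_le_subr1 (lt_le_trans ltr01 P1); lra.
by apply: powR_half_mul_le => //; rewrite (le_trans ler01).
Qed.

(** With T = 1+t and u = ln(2^j T), the first factors are T^H e^{-Hu} min(1, e^u) <= T^H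
    e^{-(1-H)|u|}, and u is within ln 2 of (j+n0) ln 2. The logarithm costs a power of 1+|j+n0|,
    absorbed by the exponential, and a power of ln(e+n0), which is of loglog size. *)
Lemma scale_le (H : R) d : 1 / 2 < H < 1 -> exists c A : R, [/\ 3 < c, 0 < A &
  forall t, 0 <= t -> exists n0 : nat, forall j : int,
  2 `^ (- j%:~R * H) * Num.min 1 (2 ^ j * (1 + t)) *
    ln (e + `|j|%:~R + d%:R * (2 ^ j * (1 + t))) `^ (d%:R / 2) <=
  A * ((1 + t) `^ H * ln (ln (c + t)) `^ (d%:R / 2)) * wt 2 (j + n0%:Z)%:~R].
Proof.
move=> /andP[H12 H1]; set l2 : R := ln 2.
have l20 : 0 < l2 by rewrite ln_gt0// ltr1n.
have l21 : l2 <= 1 by have := @ln_le_subr1 2 (ltr0n R 2); rewrite -/l2; lra.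
have [C C0 CP] : exists2 C : R, 0 < C & forall v,
    expR (- ((1 - H) * l2 * `|v|)) <= C * wt (d + 2) v.
  by apply: expRN_decay; rewrite mulr_gt0// subr_gt0.
have e0 : 0 < e by exact: expR_gt0.
have e1 : 1 <= e by rewrite -[leLHS]expR0 ler_expR.
have e2 : 2 <= e by have := expR_ge1Dx (1 : R); lra.
have il2 : 0 < l2^-1 by rewrite invr_gt0.
(* Chosen so that ln(c+t) >= e + 1/ln 2 + 1, which makes e+n0 at most ln(c+t)^2 below. *)
pose c := expR (e + l2^-1 + 1).
exists c, (e * C * (d%:R + 3) ^+ d * 2 ^+ d); split.
- by have := expR_ge1Dx (e + l2^-1 + 1); rewrite -/c; lra.
- by rewrite !mulr_gt0 ?exprn_gt0// ltr_wpDl.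
move=> t t0; pose T := 1 + t; have T1 : 1 <= T by rewrite lerDl.
have T0 : 0 < T by rewrite (lt_le_trans _ T1).
have lT0 : 0 <= ln T by rewrite ln_ge0.
(* The integer part of log_2 T, that is 2^n0 <= T < 2^(n0+1). *)
pose n0 := Num.truncn (ln T / l2); exists n0 => j.
have /andP[n01 n02] : n0%:R <= ln T / l2 < n0.+1%:R by rewrite truncn_itv// divr_ge0// ltW.
rewrite ler_pdivlMr// in n01; rewrite ltr_pdivrMr// -natr1 mulrDl mul1r in n02.
set X := 2 ^ j * (1 + t); pose m : R := (j + n0%:Z)%:~R.
have mE : m = j%:~R + n0%:R by rewrite /m intrD.
have pE : (2 ^ j : R) = expR (j%:~R * l2).
  by rewrite -powR_intmul// /powR (_ : 2 == 0 = false)// gt_eqF.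
pose u := j%:~R * l2 + ln T.
have XE : X = expR u by rewrite /X -/T pE expRD lnK.
have X0 : 0 < X by rewrite XE expR_gt0.
have uE : u = m * l2 + (ln T - n0%:R * l2) by rewrite /u mE; ring.
have ml2 : `|m * l2| = `|m| * l2 by rewrite normrM (gtr0_norm l20).
have u1 : `|m| * l2 - l2 <= `|u|.
  rewrite lerBlDr -ml2 (_ : m * l2 = u - (ln T - n0%:R * l2)); last by rewrite uE; ring.
  by rewrite (le_trans (ler_normB _ _))// lerD2l ger0_norm; lra.
have m0 := normr_ge0 m.
have u2 : `|u| <= `|m| + 1.
  rewrite uE (le_trans (ler_normD _ _))// ml2 lerD//; first by rewrite ler_piMr.
  by rewrite ger0_norm; lra.
have -> : 2 `^ (- j%:~R * H) = T `^ H * expR (- H * u) :> R.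
  rewrite /powR (_ : 2 == 0 = false) ?gt_eqF// -expRD -/l2.
  by congr expR; rewrite /u; ring.
(* H > 1/2 enters for u >= 0, through e^{-Hu} <= e^{-(1-H)u}; the factor e pays for replacing |u| by
   |m| ln 2. *)
have s1 : expR (- H * u) * Num.min 1 X <= e * (C * wt (d + 2) m).
  apply: (@le_trans _ _ (expR (- ((1 - H) * `|u|)))).
    rewrite XE; have [u0|/ltW u0] := leP 0 u.
      apply: (@le_trans _ _ (expR (- H * u) * 1)).
        by rewrite ler_wpM2l ?expR_ge0// ge_min lexx.
      by rewrite mulr1 ler_expR ger0_norm//; nra.
    apply: (@le_trans _ _ (expR (- H * u) * expR u)).
      by rewrite ler_wpM2l ?expR_ge0// ge_min lexx orbT.
    by rewrite -expRD ler_expR ler0_norm//; nra.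
  apply: le_trans (ler_wpM2l (ltW e0) (CP m)); rewrite -expRD ler_expR.
  have h1 : 0 <= 1 - H by lra.
  have := ler_wpM2l h1 u1; have : (1 - H) * l2 <= 1 by nra.
  by lra.
set E0 := e + n0%:R; have eE0 : e <= E0 by rewrite lerDl.
have d0 : 0 <= d%:R :> R by [].
have n00 : 0 <= n0%:R :> R by [].
have E00 : 0 < E0 by rewrite (lt_le_trans _ eE0).
have lE1 := ln_ge1 eE0.
have lE0 : 0 <= ln E0 by rewrite (le_trans ler01).
pose Q := (1 + `|m|) * (1 + d%:R) * (1 + X).
have Q1 : 1 <= Q.
  by rewrite !mulr_ege1// lerDl// ltW.
have jm : `|j|%:~R <= n0%:R + `|m|.
  rewrite intr_norm (_ : j%:~R = m - n0%:R); last by rewrite mE addrK.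
  by rewrite (le_trans (ler_normB _ _))// addrC lerD2r ger0_norm.
have j0 : 0 <= `|j|%:~R :> R by rewrite ler0z.
(* The argument is at most (e+n0) Q, and ln Q grows at most linearly in |m| because ln(1+X) <=
   1+|u|. *)
have l1 : ln (e + `|j|%:~R + d%:R * X) <= ln E0 * ((d%:R + 3) * (1 + `|m|)).
  apply: (@le_trans _ _ (ln (E0 * Q))).
    have Q0 : 0 < Q by rewrite (lt_le_trans _ Q1).
    have s0 : 0 < e + `|j|%:~R + d%:R * X.
      by rewrite -addrA ltr_wpDr// addr_ge0// mulr_ge0// ltW.
    have EQ0 : 0 < E0 * Q by apply: mulr_gt0.
    rewrite ler_ln ?posrE//.
    apply: (@le_trans _ _ (E0 * (1 + `|m| + d%:R * X))).
      have : 0 <= d%:R * X by rewrite mulr_ge0// ltW.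
      have : 1 <= E0 by lra.
      by rewrite /E0 in jm *; set Y := d%:R * X; nra.
    rewrite ler_wpM2l ?(ltW E00)//.
    have := mulr_ge0 m0 d0; have := mulr_ge0 m0 (ltW X0); have := mulr_ge0 d0 (ltW X0).
    have := mulr_ge0 (mulr_ge0 m0 d0) (ltW X0); rewrite /Q; nra.
  apply: le_trans (ln_mul_le eE0 Q1) _.
  rewrite ler_wpM2l//.
  have m1 : 0 < 1 + `|m| by lra.
  have d1 : 0 < 1 + d%:R :> R by lra.
  have x1 : 0 < 1 + X by lra.
  rewrite /Q !lnM ?posrE ?mulr_gt0//.
  have := ln_le_subr1 m1; have := ln_le_subr1 d1.
  have : ln (1 + X) <= 1 + `|u|.
    apply: (@le_trans _ _ (ln (2 * expR `|u|))).
      rewrite ler_ln ?posrE ?mulr_gt0 ?expR_gt0// XE.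
      have : expR u <= expR `|u| by rewrite ler_expR ler_norm.
      have : 1 <= expR `|u| by rewrite -[leLHS]expR0 ler_expR.
      by lra.
    by rewrite lnM ?posrE ?expR_gt0// expRK lerD2r.
  by have := mulr_ge0 m0 d0; nra.
set LL := ln (ln (c + t)).
have lc : e + l2^-1 + 1 <= ln (c + t).
  rewrite -[leLHS]expRK ler_ln ?posrE ?expR_gt0//; first by rewrite lerDl.
  by rewrite ltr_wpDr// expR_gt0.
have Y0 : 0 < ln (c + t) by lra.
have LL0 : 0 <= LL by rewrite ln_ge0//; lra.
(* Here n0 <= ln(c+t)/ln 2, so by the choice of [c] e+n0 is at most the square of ln(c+t); the
   square gives the factor 2. *)
have l3 : ln E0 <= LL * 2.
  have -> : LL * 2 = ln (ln (c + t) ^+ 2) by rewrite lnXn// mulr_natr.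
  rewrite ler_ln ?posrE ?exprn_gt0//.
  have lTc : ln T <= ln (c + t).
    rewrite ler_ln ?posrE//; first by rewrite /T lerD2r -[leLHS]expR0 ler_expR; lra.
    by rewrite ltr_wpDr// expR_gt0.
  have n0l : n0%:R <= l2^-1 * ln (c + t).
    by rewrite ler_pdivlMl// mulrC (le_trans n01).
  rewrite /E0; set Y := ln (c + t) in lc Y0 lTc n0l *.
  by nra.
have mm : 1 <= 1 + `|m| by lra.
have powle : ln (e + `|j|%:~R + d%:R * X) `^ (d%:R / 2) <=
    LL `^ (d%:R / 2) * 2 ^+ d * ((d%:R + 3) ^+ d * (1 + `|m|) ^+ d).
  have l0 : 0 <= ln (e + `|j|%:~R + d%:R * X).
    by rewrite ln_ge0// -addrA (le_trans e1)// lerDl addr_ge0// mulr_ge0// ltW.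
  apply: le_trans (le_powR_half _ l0 l1) _.
  apply: le_trans (powR_half_mul_le _ _ _) _.
  - by [].
  - by rewrite mulr_ege1//; lra.
  have d30 : 0 <= (d%:R + 3) ^+ d * (1 + `|m|) ^+ d :> R.
    by rewrite mulr_ge0// exprn_ge0//; lra.
  rewrite (exprMn d (d%:R + 3)) ler_wpM2r//.
  apply: le_trans (le_powR_half _ lE0 l3) _.
  by apply: powR_half_mul_le => //; rewrite ler1n.
rewrite -mulrA.
have TH : 0 <= T `^ H by exact: powR_ge0.
rewrite -/T -/LL.
have -> : e * C * (d%:R + 3) ^+ d * 2 ^+ d * (T `^ H * LL `^ (d%:R / 2)) * wt 2 m =
  T `^ H * ((e * (C * wt (d + 2) m)) *
    (LL `^ (d%:R / 2) * 2 ^+ d * ((d%:R + 3) ^+ d * (1 + `|m|) ^+ d))).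
  have -> : wt 2 m = (1 + `|m|) ^+ d * wt (d + 2) m by rewrite wtD mulrA wtVK mul1r.
  by ring.
rewrite -mulrA ler_wpM2l// mulrA ler_pM ?mulr_ge0 ?expR_ge0 ?powR_ge0//.
by rewrite le_min ler01 ltW.
Qed.

End log_weights.

(** * Bound on the wavelet series *)

Section wavelet_series_bound.
Variable R : realType.

(** The positive and negative parts then have finite sums in [0, M], so [fine] takes no default
    value and the difference lies in [-M, M]. *)
Lemma abs_sum_le (T : choiceType) (D : set T) (f : T -> R) (M : R) :
  (forall s : seq T, uniq s -> (forall z, z \in s -> D z) -> \sum_(z <- s) `|f z| <= M) ->
  `|abs_sum D f| <= M.
Proof.
move=> fM.
have half (g : T -> R) : (forall z, 0 <= g z <= `|f z|) ->
    0 <= fine (\esum_(i in D) (g i)%:E) <= M.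
  move=> gf.
  have g0 : (0 <= \esum_(i in D) (g i)%:E)%E.
    by apply: esum_ge0 => z _; rewrite lee_fin; case/andP: (gf z).
  have gM : (\esum_(i in D) (g i)%:E <= M%:E)%E.
    apply: ub_ereal_sup => _ [A [finA AD] <-].
    rewrite fsbig_finite// sumEFin lee_fin.
    apply: le_trans (fM (fset_set A) (fset_uniq _) _).
      by apply: ler_sum => z _; case/andP: (gf z).
    by move=> z; rewrite in_fset_set// => /set_mem/AD.
  rewrite fine_ge0//= -lee_fin fineK// ge0_fin_numE//.
  by rewrite (le_lt_trans gM)// ltry.
have /andP[a0 aM] : 0 <= fine (\esum_(i in D) (Num.max (f i) 0)%:E) <= M.
  by apply: half => z; rewrite le_max lexx orbT ge_max ler_norm normr_ge0.
have /andP[b0 bM] : 0 <= fine (\esum_(i in D) (Num.max (- f i) 0)%:E) <= M.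
  by apply: half => z; rewrite le_max lexx orbT ge_max ler_normr lexx orbT normr_ge0.
by rewrite /abs_sum ler_norml; apply/andP; split; lra.
Qed.

Variable d : nat.

Definition wavelet_index := (int * d.-tuple int * d.-tuple bool)%type.

Definition log_weight (z : wavelet_index) : R :=
  ln (expR 1 + `|z.1.1|%:~R + (\sum_(i < d) `|tnth z.1.2 i|)%:~R) `^ (d%:R / 2).

Definition potential_increment (Theta : d.-tuple bool -> d.-tuple R -> R) (t : R)
    (z : wavelet_index) : R :=
  Theta z.2 (dilate z.1.1 z.1.2 (diag_tuple d t)) -
  Theta z.2 (dilate z.1.1 z.1.2 (diag_tuple d 0)).

(** Of the d+2 powers, d pay for the logarithmic weight and 2 for the summation over k. *)
Definition localized (K : R) (Theta : d.-tuple bool -> d.-tuple R -> R) :=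
  forall eps, nonzero_type eps -> forall x,
    `|Theta eps x| <= K * \prod_(i < d) wt (d + 2) (tnth x i) /\
    forall s, 0 <= s <= 1 ->
      `|Theta eps (shift_tuple x s) - Theta eps x| <=
        s * K * \prod_(i < d) wt (d + 2) (tnth x i).

(** For X >= 1 the two values are bounded separately; for X <= 1 the points differ by the diagonal
    shift 2^j t <= X, whence the minimum. Then [weight_le], applied at both points, removes k from
    the logarithm. *)
Lemma potential_increment_le K Theta t (z : wavelet_index) :
  localized K Theta -> 0 <= K -> 0 <= t ->
  nonzero_type z.2 ->
  let X := 2 ^ z.1.1 * (1 + t) in
  `|potential_increment Theta t z| * log_weight z <=
  K * Num.min 1 X * ln (expR 1 + `|z.1.1|%:~R + d%:R * X) `^ (d%:R / 2) *
  (\prod_(i < d) wt 2 (2 ^ z.1.1 * t - (tnth z.1.2 i)%:~R) +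
   \prod_(i < d) wt 2 (0 - (tnth z.1.2 i)%:~R)).
Proof.
case: z => -[j k] eps loc K0 t0 /= nz; rewrite /potential_increment /log_weight/=.
set X := 2 ^ j * (1 + t).
have p0 : 0 < 2 ^ j :> R by rewrite exprz_gt0.
have X0 : 0 < X by rewrite mulr_gt0// ltr_wpDr.
have tX : 2 ^ j * t <= X by rewrite ler_pM2l// lerDr.
set y := dilate j k (diag_tuple d t); set y0 := dilate j k (diag_tuple d 0).
have yE i : tnth y i = 2 ^ j * t - (tnth k i)%:~R by rewrite !tnth_mktuple.
have y0E i : tnth y0 i = 0 - (tnth k i)%:~R by rewrite !tnth_mktuple mulr0.
have yy0 : y = shift_tuple y0 (2 ^ j * t).
  by apply: eq_from_tnth => i; rewrite yE tnth_mktuple y0E sub0r addrC.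
pose W x := \prod_(i < d) @wt R (d + 2) (tnth x i).
have W0 x : 0 <= W x by apply: prodr_ge0 => i _; exact: wt_ge0.
have dT : `|Theta eps y - Theta eps y0| <= K * Num.min 1 X * (W y + W y0).
  have [X1|/ltW X1] := leP 1 X.
    rewrite mulr1 mulrDr (le_trans (ler_normB _ _))// lerD//.
      by have [] := loc eps nz y.
    by have [] := loc eps nz y0.
  have s01 : 0 <= 2 ^ j * t <= 1 by rewrite mulr_ge0 ?(ltW p0)//= (le_trans tX).
  have [_ /(_ _ s01)] := loc eps nz y0; rewrite -yy0 => /le_trans; apply.
  rewrite -/(W y0) (@le_trans _ _ (K * X * W y0))//.
    by rewrite ler_wpM2r// mulrC ler_wpM2l.
  by rewrite ler_wpM2l ?lerDr// (mulr_ge0 K0 (ltW X0)).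
set L := _ `^ _; set E := _ `^ _.
have wE x : (forall i, `|tnth k i|%:~R <= `|tnth x i| + X) ->
    L * W x <= E * \prod_(i < d) wt 2 (tnth x i).
  by move=> kx; apply: weight_le => //; rewrite ?ler0z// ltW.
apply: le_trans (ler_wpM2r (powR_ge0 _ _) dT) _.
rewrite -!mulrA ler_wpM2l// ler_wpM2l//; first by rewrite le_min ler01 ltW.
rewrite mulrC mulrDr mulrDr; apply: lerD.
  under [X in _ <= _ * X]eq_bigr => i _ do rewrite -yE.
  apply: wE => i; rewrite yE intr_norm.
  rewrite -[X in `|X| <= _](subKr (2 ^ j * t)) (le_trans (ler_normB _ _))//.
  by rewrite addrC lerD2l ger0_norm// mulr_ge0// ltW.
under [X in _ <= _ * X]eq_bigr => i _ do rewrite -y0E.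
by apply: wE => i; rewrite y0E sub0r normrN intr_norm lerDl ltW.
Qed.

(** The level j is bounded by [wt 2] at j + n0; translation by n0 being injective, the sum over j
    does not see n0, hence is uniform in t. *)
Lemma wavelet_sum_le (H : R) : 1 / 2 < H < 1 -> exists c A : R, [/\ 3 < c, 0 < A &
  forall K Theta, localized K Theta -> 0 <= K -> forall t, 0 <= t ->
  forall s : seq wavelet_index, uniq s -> (forall z, z \in s -> nonzero_type z.2) ->
  \sum_(z <- s) 2 `^ (- z.1.1%:~R * H) * (`|potential_increment Theta t z| * log_weight z) <=
  K * A * ((1 + t) `^ H * ln (ln (c + t)) `^ (d%:R / 2))].
Proof.
move=> H01; have [c [A [c3 A0 scale]]] := scale_le d H01.
(* The sum over j, the sums over k around 2^j t and around 0, and the number of types. *)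
pose N : R := 4 * (16 ^+ d + 16 ^+ d) * #|{: d.-tuple bool}|%:R.
have N0 : 0 <= N by rewrite !mulr_ge0// addr_ge0// exprn_ge0.
exists c, (A * (N + 1)); split => // [|K Theta loc K0 t t0 s us nz].
  by rewrite mulr_gt0// ltr_wpDl.
have [n0 n0P] := scale t t0.
set B := (1 + t) `^ H * _; have B0 : 0 <= B by rewrite mulr_ge0 ?powR_ge0.
pose g (j : int) : R := wt 2 (j + n0%:Z)%:~R.
pose h (j : int) (k : d.-tuple int) : R :=
  \prod_(i < d) wt 2 (2 ^ j * t - (tnth k i)%:~R) +
  \prod_(i < d) wt 2 (0 - (tnth k i)%:~R).
have g0 j : 0 <= g j by exact: wt_ge0.
have h0 j k : 0 <= h j k by rewrite addr_ge0// prodr_ge0// => i _; exact: wt_ge0.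
have gS : sum_le g 4.
  by apply: (sum_le_inj (h := fun j : int => j + n0%:Z) _ (sum_le_int R)); exact: addIr.
have hS j : sum_le (h j) (16 ^+ d + 16 ^+ d).
  apply: sum_leD.
    apply: (sum_le_tuple (f := fun k : int => wt 2 (2 ^ j * t - k%:~R))) => [x|].
      exact: wt_ge0.
    exact: sum_le_shift.
  apply: (sum_le_tuple (f := fun k : int => wt 2 (0 - k%:~R))) => [x|].
    exact: wt_ge0.
  exact: sum_le_shift.
have S1 := sum_le_pair g0 gS (sum_le_ge0 (hS 0)) hS.
have S2 := sum_le_pair (fun p : int * d.-tuple int => mulr_ge0 (g0 p.1) (h0 p.1 p.2)) S1
  (ler0n R #|{: d.-tuple bool}|) (fun _ => @sum_le_fin R _).
have KAB : 0 <= K * A * B by rewrite mulr_ge0// mulr_ge0// ltW.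
apply: (@le_trans _ _ (K * A * B * N)); last first.
  have -> : K * (A * (N + 1)) * B = K * A * B * N + K * A * B by ring.
  by rewrite lerDl.
apply: le_trans (sum_leZ KAB S2 us).
rewrite big_seq_cond [leRHS]big_seq_cond; apply: ler_sum => -[[j k] eps].
rewrite andbT => /nz nze.
have := potential_increment_le loc K0 t0 nze; rewrite /= -/(h j k) mulr1 => le1.
apply: le_trans (ler_wpM2l (powR_ge0 _ _) le1) _.
set X := 2 ^ j * (1 + t) in le1 *.
have -> : 2 `^ (- j%:~R * H) * (K * Num.min 1 X *
    ln (expR 1 + `|j|%:~R + d%:R * X) `^ (d%:R / 2) * h j k) =
  (2 `^ (- j%:~R * H) * Num.min 1 X * ln (expR 1 + `|j|%:~R + d%:R * X) `^ (d%:R / 2)) *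
  (K * h j k) by ring.
apply: le_trans (ler_wpM2r _ (n0P j)) _; first by rewrite mulr_ge0.
by rewrite -/(g j) -/B le_eqVlt; apply/orP; left; apply/eqP; ring.
Qed.

End wavelet_series_bound.

(** * From the deterministic estimate to the pathwise bound *)

Theorem proposition5 (R : realType) (disp : measure_display)
    (Omega : measurableType disp) (P : probability Omega R)
    (B : R -> {RV P >-> R}) (d : nat) (H alpha : R)
    (Id : (d.-tuple R -> R) -> Omega -> R) (phi psi : R -> R)
    (Omega_star : set Omega) (X : R -> {RV P >-> R}) :
  two_sided_brownian B ->
  generated_by (fun t => B t : Omega -> R) ->
  (1 <= d)%N ->
  1 / 2 < H < 1 ->
  alpha = H + d%:R / 2 - 1 ->
  multiple_Wiener_Ito B Id ->
  Lemarie_Meyer phi psi ->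
  is_Omega_star P Id phi psi Omega_star ->
  (forall t, 0 <= t ->
    {ae P, forall w, X t w = Id (riesz_increment alpha t) w}) ->
  (forall w, Omega_star w -> forall t, 0 <= t ->
    X t w = wavelet_series Id phi psi H alpha t w) ->
  exists (Bd : {RV P >-> R}) (c : R),
    [/\ forall w, 0 < Bd w, moments_finite P Bd, 3 < c &
     forall w, Omega_star w ->
       (ereal_sup
          [set (`|X t w| /
                ((1 + `|t|) `^ H * ln (ln (c + `|t|)) `^ (d%:R / 2)))%:E
          | t in [set t : R | (0 <= t)%R]]
        <= (Bd w)%:E)%E].
Proof.
move=> _ _ d1 H01 alphaE _ LM [_ _ [C [C0 Cmom Cle]]] _ XE.
have s1 : alpha + 1 = H + d%:R / 2 by rewrite alphaE subrK.
have rpsi := LM_psi_schwartz LM.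
have [K K0 loc] := riesz_tensor_bounds (d + 2) d1 H01
  (schwartz_rapid (LM_phi_schwartz LM)) (schwartz_rapid rpsi)
  (schwartz_vanishing_moments rpsi (LM_moments LM)).
pose Theta (eps : d.-tuple bool) := riesz_potential (alpha + 1) (tensor_wavelet phi psi eps).
have {}loc : localized K Theta.
  by move=> eps nz x; rewrite /Theta s1; exact: (loc eps nz x).
have [c [A [c3 A0 sumle]]] := wavelet_sum_le d H01.
(* The added 1 makes M C strictly positive even if K = 0. *)
pose M := K * A + 1; have M0 : 0 < M by rewrite ltr_wpDl// mulr_ge0// ltW.
have mC : measurable_fun setT (fun w => M * C w) by exact: measurable_funM.
pose Bd : {RV P >-> R} := HB.pack (fun w => M * C w) (isMeasurableFun.Build _ _ _ _ _ mC).
exists Bd, c; split => //.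
- by move=> w; exact: mulr_gt0.
- move=> p; rewrite (_ : (fun w => _) = fun w => ((M ^+ p)%:E * (`|C w| ^+ p)%:E)%E).
    by apply: integrableZl (Cmom p).
  by apply/funext => w; rewrite /= normrM exprMn (gtr0_norm M0) EFinM.
move=> w Ow; apply: ub_ereal_sup => _ [t /= t0 <-].
rewrite lee_fin (ger0_norm t0).
set D := (1 + t) `^ H * _; have D0 : 0 <= D by rewrite mulr_ge0 ?powR_ge0.
(* For a zero denominator the quotient is 0 by convention, which is below the positive [Bd]. *)
have [->|Dn0] := eqVneq D 0; first by rewrite invr0 mulr0 ltW// mulr_gt0.
rewrite ler_pdivrMr ?lt_def ?Dn0//= XE//.
apply: (@le_trans _ _ (C w * (K * A * D))); last first.
  rewrite /= (mulrC M) -[leRHS]mulrA ler_wpM2l ?(ltW (C0 w))//.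
  by rewrite ler_wpM2r// lerDl.
(* On [Omega_star] each coefficient is at most C(w) times the logarithmic weight, so finite sums of
   the series are dominated by C(w) times the deterministic ones. *)
apply: abs_sum_le => s us nz.
apply: le_trans (ler_wpM2l (ltW (C0 w)) (sumle K Theta loc K0 t t0 s us nz)).
rewrite mulr_sumr big_seq_cond [leRHS]big_seq_cond; apply: ler_sum => -[[j k] eps].
rewrite andbT => /nz nze; rewrite !normrM ger0_norm ?powR_ge0//.
rewrite mulrCA -mulrA ler_wpM2l ?powR_ge0// mulrCA ler_wpM2l//.
exact: Cle.
Qed.
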